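(* Let $\mathbb{G}$ be a stratified Lie group of homogeneous dimension $Q$, and let $\Omega\subset\mathbb{G}$ be a nonempty bounded open set. Let $s\in(0,1)$ and $p\in(1,\infty)$ be such that $\frac{Q}{s}>p\ge2$. Suppose that $m$ and $q$ are two real constants such that $$1\le m<p\le q<p_s^*=\frac{pQ}{Q-ps}.$$ Then there exists an open interval $\Lambda\subset(0,+\infty)$ such that for every $\lambda\in\Lambda$ the problem $$(-\Delta_{\mathbb{G},p})^su=|u|^{p_s^*-2}u+\lambda\left(|u|^{m-1}+|u|^{q-1}\right)\ \text{ in }\Omega,\qquad u=0\ \text{ in }\mathbb{G}\setminus\Omega,$$ has at least one nonnegative nontrivial weak solution $u_\lambda\in X_0^{s,p}(\Omega)$.
   Context: ''Open interval'' means a nonempty open interval. Stratified Lie group: $\mathbb{G}=(\mathbb{R}^N,\circ,D_\lambda)$, a Lie group on $\mathbb{R}^N=\mathbb{R}^{N_1}\times\cdots\times\mathbb{R}^{N_k}$ such that for each $\lambda>0$ the dilation $D_\lambda(x)=(\lambda x^{(1)},\lambda^2x^{(2)},\dots,\lambda^kx^{(k)})$, $x^{(i)}\in\mathbb{R}^{N_i}$, is a group automorphism, and such that the left-invariant vector fields $X_1,\dots,X_{N_1}$ with $X_i(0)=\partial/\partial x_i|_0$ generate the whole Lie algebra of $\mathbb{G}$ (the Lie algebra they generate has rank $N$ at every point). The homogeneous dimension is $Q=\sum_{i=1}^k iN_i$. Haar measure $dx$ is Lebesgue measure on $\mathbb{R}^N$. $|\cdot|$ on $\mathbb{G}$ is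 a fixed homogeneous quasi-norm: a continuous function $\mathbb{G}\to[0,\infty)$ with $|x^{-1}|=|x|$, $|x|=0$ iff $x=0$, $|D_\lambda x|=\lambda|x|$; $y^{-1}x=y^{-1}\circ x$. Function space: $[u]_{s,p,\mathbb{G}}=\left(\iint_{\mathbb{G}\times\mathbb{G}}\frac{|u(x)-u(y)|^p}{|y^{-1}x|^{Q+ps}}dx\,dy\right)^{1/p}$, $W^{s,p}(\mathbb{G})=\{u\in L^p(\mathbb{G}):[u]_{s,p,\mathbb{G}}<\infty\}$, $X_0^{s,p}(\Omega)=\{u\in W^{s,p}(\mathbb{G}):u=0\text{ in }\mathbb{G}\setminus\Omega\}$, with norm $\|u\|_{X_0^{s,p}(\Omega)}=[u]_{s,p,\mathbb{G}}$ (for bounded $\Omega$). Functions are real-valued. Operator: $(-\Delta_{\mathbb{G},p})^su(x)=C(Q,s,p)\,\mathrm{P.V.}\int_{\mathbb{G}}\frac{|u(x)-u(y)|^{p-2}(u(x)-u(y))}{|y^{-1}x|^{Q+ps}}dy$, with a positive normalization constant $C(Q,s,p)$ that is omitted (taken to be 1) in the weak formulation. A weak solution of $(-\Delta_{\mathbb{G},p})^su=f(x,u)$ in $\Omega$, $u=0$ in $\mathbb{G}\setminus\Omega$, is $u\in X_0^{s,p}(\Omega)$ with $$\iint_{\mathbb{G}\times\mathbb{G}}\frac{|u(x)-u(y)|^{p-2}(u(x)-u(y))(\varphi(x)-\varphi(y))}{|y^{-1}x|^{Q+ps}}dx\,dy=\int_\Omega f(x,u(x))\varphi(x)\,dx\quad\forall\varphi\in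 X_0^{s,p}(\Omega).$$ *)

(* Defs.v *)
From HB Require Import structures.
From mathcomp Require Import all_boot all_order all_algebra.
From mathcomp Require Import all_classical all_reals all_analysis.
From mathcomp Require Import measurable_realfun.

Set Implicit Arguments.
Unset Strict Implicit.
Unset Printing Implicit Defensive.

Import Order.TTheory GRing.Theory Num.Theory.
Import numFieldNormedType.Exports.

Local Open Scope classical_set_scope.
Local Open Scope ring_scope.

(* 'rV[R]_n carries the Borel sigma-algebra of its usual topology *)
Section borel_rV.
Context (R : realType) (n : nat).
HB.instance Definition _ := Measurable.copy 'rV[R]_n
  (g_sigma_algebraType (@open 'rV[R]_n)).
End borel_rV.

Section measurable_rV.
Context (R : realType) (n : nat).

Lemma measurable_coord_rV (i : 'I_n) :
  measurable_fun setT (fun x : 'rV[R]_n => x 0 i).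
Proof.
apply: (measurability _ (RGenOpens.measurableE R)) => _ [_ [a [b ->]] <-].
rewrite setTI; apply: sub_sigma_algebra => /=.
by apply: open_comp => // x _; exact: coord_continuous.
Qed.

Let rat_box (q : 'rV[rat]_n * rat) : set 'rV[R]_n :=
  [set x | forall i, ball (ratr (q.1 0 i) : R) (ratr q.2) (x 0 i)].

Let open_bigcup_rat_box (U : set 'rV[R]_n) : open U ->
  U = \bigcup_(q in [set q | rat_box q `<=` U]) rat_box q.
Proof.
move=> oU; apply/seteqP; split => [x Ux|x [q /= qU]]; last exact: qU.
have [e /= e0 eU] : nbhs_ball x U by rewrite nbhs_ballE; exact: open_nbhs_nbhs.
have [|r] := @rat_in_itvoo R 0 (e / 2); first by rewrite divr_gt0.
rewrite in_itv/= => /andP[r0 re].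
have re2 : ratr r + ratr r < e by rewrite [ltRHS](splitr e) ltrD.
have /choice[q hq] : forall i, exists q : rat, ball (ratr q : R) (ratr r) (x 0 i).
  move=> i; have [|q] := @rat_in_itvoo R (x 0 i - ratr r) (x 0 i + ratr r).
    by rewrite ltrBlDr -addrA ltrDl addr_gt0.
  by rewrite in_itv/= => qi; exists q; rewrite /ball/= distrC ltr_distlC.
exists (\row_i q i, r) => /= [y hy|i]; last by rewrite mxE.
apply: eU; split => //= i j; rewrite (ord1 i).
apply: (le_ball (ltW re2)); apply: (@ball_triangle _ _ (ratr (q j) : R)).
  exact/ball_sym.
by have := hy j; rewrite mxE.
Qed.

Lemma measurable_fun_rV d (T : measurableType d) (f : T -> 'rV[R]_n) :
  (forall i, measurable_fun setT (fun t => f t 0 i)) -> measurable_fun setT f.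
Proof.
move=> mf; apply: (measurability (@open 'rV[R]_n)) => // _ [U oU <-].
rewrite setTI (open_bigcup_rat_box oU) preimage_bigcup.
rewrite bigcup_mkcond; apply: countable_bigcupT_measurable => [|q].
  exact: countableP.
case: ifPn => // _.
rewrite (_ : _ @^-1` _ = \bigcap_(i in [set: 'I_n])
   ((fun t => f t 0 i) @^-1` (ball (ratr (q.1 0 i) : R) (ratr q.2)))).
  apply: fin_bigcap_measurable => // i _.
  by rewrite -[X in measurable X]setTI; apply: mf => //; rewrite ball_itv.
by apply/seteqP; split => t /= h i *; apply: h.
Qed.

End measurable_rV.

Section lebesgue_rV.
Context (R : realType).

(* Iterated product of the one-dimensional Lebesgue measure; lebesgue_rV_box
   gives its value on boxes, which characterizes it. *)
Definition rV_cons n (z : 'rV[R]_n * measurableTypeR R) : 'rV[R]_(1 + n) :=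
  row_mx (z.2 : R)%:M z.1.

Fixpoint lebesgue_rV (n : nat) : set 'rV[R]_n -> \bar R :=
  match n return set 'rV[R]_n -> \bar R with
  | 0 => \d_(0 : 'rV[R]_0)
  | n'.+1 => pushforward (@lebesgue_rV n' \x @lebesgue_measure R)%E (@rV_cons n')
  end.

Let rV_cons0 n z (i : 'I_1) : @rV_cons n z 0 (lshift n i) = z.2.
Proof. by rewrite row_mxEl (ord1 i) mxE eqxx. Qed.

Let rV_consS n z (i : 'I_n) : @rV_cons n z 0 (rshift 1 i) = z.1 0 i.
Proof. by rewrite row_mxEr. Qed.

Let measurable_rV_cons n : measurable_fun setT (@rV_cons n).
Proof.
apply: measurable_fun_rV => i; case: (splitP i) => j ij.
  rewrite (_ : (fun _ => _) = snd); first exact: measurable_snd.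
  by apply/funext => z; rewrite (_ : i = lshift n j) ?rV_cons0//; exact: val_inj.
rewrite (_ : (fun _ => _) = (fun x : 'rV[R]_n => x 0 j) \o fst).
  apply: measurableT_comp; [exact: measurable_coord_rV|exact: measurable_fst].
by apply/funext => z; rewrite (_ : i = rshift 1 j) ?rV_consS//; exact: val_inj.
Qed.

Let lebesgue_rV_measure n :
  exists m : {measure set 'rV[R]_n -> \bar R}, @lebesgue_rV n = m.
Proof.
elim: n => [|n [m lm]]; first by exists (\d_(0 : 'rV[R]_0)).
rewrite /= lm.
pose p := (m \x @lebesgue_measure R)%E : {measure set _ -> \bar R}.
pose P := measure_function_pushforward__canonical__measure_function_Measure
  p (@measurable_rV_cons n).
by exists P.
Qed.

Let lebesgue_rV0 n : @lebesgue_rV n set0 = 0%E.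
Proof. by have [m ->] := lebesgue_rV_measure n. Qed.

Let lebesgue_rV_ge0 n A : (0 <= @lebesgue_rV n A)%E.
Proof. by have [m ->] := lebesgue_rV_measure n. Qed.

Let lebesgue_rV_semi_sigma_additive n : semi_sigma_additive (@lebesgue_rV n).
Proof.
by have [m ->] := lebesgue_rV_measure n; exact: measure_semi_sigma_additive.
Qed.

HB.instance Definition _ n := isMeasure.Build _ _ _ (@lebesgue_rV n)
  (@lebesgue_rV0 n) (@lebesgue_rV_ge0 n) (@lebesgue_rV_semi_sigma_additive n).

Definition box n (a b : 'rV[R]_n) : set 'rV[R]_n :=
  [set x | forall i, x 0 i \in `]a 0 i, b 0 i]].

Lemma measurable_box n (a b : 'rV[R]_n) : measurable (box a b).
Proof.
rewrite (_ : box a b = \bigcap_(i in [set: 'I_n])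
   ((fun x : 'rV[R]_n => x 0 i) @^-1` `]a 0 i, b 0 i]%classic)).
  apply: fin_bigcap_measurable => // i _; rewrite -[X in measurable X]setTI.
  exact: measurable_coord_rV.
by apply/seteqP; split => x h i *; apply: h.
Qed.

Lemma lebesgue_rV_box n (a b : 'rV[R]_n) : (forall i, a 0 i <= b 0 i) ->
  lebesgue_rV (box a b) = (\prod_(i < n) (b 0 i - a 0 i))%:E.
Proof.
elim: n a b => [|n IHn] a b ab.
  by rewrite big_ord0 /= diracE mem_set// => -[].
pose a' : 'rV[R]_n := rsubmx (a : 'rV_(1 + n)).
pose b' : 'rV[R]_n := rsubmx (b : 'rV_(1 + n)).
rewrite /= /pushforward.
have e0 : 0 = lshift n 0 :> 'I_(1 + n) by exact: val_inj.
have eS i : lift ord0 i = rshift 1 i :> 'I_(1 + n) by exact: val_inj.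
rewrite (_ : _ @^-1` _ = box a' b' `*` `]a 0 0, b 0 0]%classic); last first.
  apply/seteqP; split => [z h|z [h1 h2] i].
    split => [i|]; last by have := h (lshift n (0 : 'I_1)); rewrite rV_cons0 -!e0.
    by have := h (rshift 1 i : 'I_(1 + n)); rewrite rV_consS !mxE.
  case: (unliftP ord0 i) => [j ->|->].
    by have := h1 j; rewrite -rV_consS !mxE -!eS.
  by move: h2 => /=; rewrite -(rV_cons0 z 0) -e0.
rewrite product_measure1E//=; last exact: measurable_box.
rewrite IHn; last by move=> i; rewrite !mxE.
rewrite lebesgue_measure_itv/= lte_fin big_ord_recl.
have -> : (if (a 0 0 < b 0 0)%R then (b 0%R 0%R)%:E - (a 0%R 0%R)%:E else 0)%E =
    (b 0 0 - a 0 0)%:E.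
  case: ltP => // ba; rewrite (_ : b 0 0 = a 0 0) ?subrr//.
  by apply/eqP; rewrite eq_le ba ab.
rewrite -EFinM mulrC; congr (_ * _)%:E.
by apply: eq_bigr => i _; rewrite !mxE -!eS.
Qed.

Let lebesgue_rV_sigma_finite n : sigma_finite setT (@lebesgue_rV n).
Proof.
pose F (k : nat) : set 'rV[R]_n := box (const_mx (- k%:R)) (const_mx k%:R).
exists F => [|k].
  apply/esym/seteqP; split => // x _.
  pose c i := Num.bound `|x 0 i|.
  exists (\max_i c i)%N => // i; rewrite !mxE in_itv/=.
  have : `|x 0 i| < (\max_i c i)%N%:R.
    by rewrite (lt_le_trans (archi_boundP _))// ler_nat (leq_bigmax i).
  by rewrite ltr_norml => /andP[-> /ltW].
split; first exact: measurable_box.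
rewrite lebesgue_rV_box ?ltry// => i; rewrite !mxE.
by rewrite (le_trans _ (ler0n _ _))// oppr_le0.
Qed.

HB.instance Definition _ n := Measure_isSigmaFinite.Build _ _ _ (@lebesgue_rV n)
  (@lebesgue_rV_sigma_finite n).

End lebesgue_rV.
Arguments lebesgue_rV R n : clear implicits.

Section smooth.
Context (R : realType).

(* Directional derivatives are taken along all vectors, so on finite-dimensional
   spaces this is the usual class C^m. *)
Fixpoint Ck (V W : normedModType R) (m : nat) (f : V -> W) : Prop :=
  match m with
  | 0 => continuous f
  | m'.+1 => (forall x v, derivable f x v) /\ (forall v, Ck m' ('D_v f))
  end.

Definition smooth (V W : normedModType R) (f : V -> W) := forall m, Ck m f.

End smooth.

Section vector_fields.
Context (R : realType) (V : normedModType R).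
Implicit Types X Y : V -> V.

Definition lie_bracket X Y : V -> V := fun x => 'D_(X x) Y x - 'D_(Y x) X x.

Inductive lie_generated (S : set (V -> V)) : set (V -> V) :=
| lie_generated_mem X : S X -> lie_generated S X
| lie_generated_0 : lie_generated S (fun=> 0)
| lie_generated_lin (a : R) X Y : lie_generated S X -> lie_generated S Y ->
    lie_generated S (fun x => a *: X x + Y x)
| lie_generated_bracket X Y : lie_generated S X -> lie_generated S Y ->
    lie_generated S (lie_bracket X Y).

(* X (y o x) = d(L_y)_x (X x), where L_y = op y is the left translation *)
Definition left_invariant (op : V -> V -> V) X :=
  forall y x, X (op y x) = 'D_(X x) (op y) x.

End vector_fields.

Section stratified_group.
Context (R : realType) (k : nat) (n : 'I_k.+1 -> nat).
Local Notation V := 'rV[R]_(\sum_(i < k.+1) n i).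

(* blocks are numbered from 0, so that block i has weight i.+1 *)
Definition dilation (l : R) (x : V) : V :=
  \mxrow_(i < k.+1) (l ^+ i.+1 *: submxrow x i).

Definition horizontal_dir (j : 'I_(n ord0)) : V :=
  delta_mx 0 (tagnat.Rank ord0 j).

Definition homogeneous_dim : nat := (\sum_(i < k.+1) i.+1 * n i)%N.

(* The unit is 0: it is fixed by every dilation. *)
Record stratified_group := StratifiedGroup {
  sg_op : V -> V -> V ;
  sg_inv : V -> V ;
  sg_opA : associative sg_op ;
  sg_op0x : left_id 0 sg_op ;
  sg_opx0 : right_id 0 sg_op ;
  sg_opVx : left_inverse 0 sg_inv sg_op ;
  sg_opxV : right_inverse 0 sg_inv sg_op ;
  sg_op_smooth : smooth (fun z : V * V => sg_op z.1 z.2) ;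
  sg_inv_smooth : smooth sg_inv ;
  sg_dilationM : forall l x y, 0 < l ->
    dilation l (sg_op x y) = sg_op (dilation l x) (dilation l y) ;
  sg_stratified : left_invariant sg_op `<=`
    lie_generated [set X | left_invariant sg_op X /\
                           exists j, X 0 = horizontal_dir j]
}.

Record homogeneous_norm (G : stratified_group) := HomogeneousNorm {
  hnorm :> V -> R ;
  hnorm_continuous : continuous hnorm ;
  hnorm_ge0 : forall x, 0 <= hnorm x ;
  hnorm_inv : forall x, hnorm (sg_inv G x) = hnorm x ;
  hnorm_eq0 : forall x, hnorm x = 0 <-> x = 0 ;
  hnorm_dilation : forall l x, 0 < l -> hnorm (dilation l x) = l * hnorm x
}.

End stratified_group.

Section fractional_p_sublaplacian.
Context (R : realType) (k : nat) (n : 'I_k.+1 -> nat).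
Local Notation V := 'rV[R]_(\sum_(i < k.+1) n i).
Local Notation Q := ((homogeneous_dim n)%:R : R).
Local Notation mu := (lebesgue_rV R (\sum_(i < k.+1) n i)).
Context (G : stratified_group R n) (N : homogeneous_norm G) (s p : R).
Implicit Types u phi : V -> R.

(* |y^-1 o x| ^ (Q + p s) for z = (x, y). Its value 0 on the diagonal x = y is
   irrelevant: the diagonal is negligible and the numerators vanish there. *)
Definition kernel_weight (z : V * V) : R :=
  N (sg_op G (sg_inv G z.2) z.1) `^ (Q + p * s).

Definition gagliardo u : \bar R :=
  ((\int[(mu \x mu)%E]_z
      (`|u z.1 - u z.2| `^ p / kernel_weight z)%:E) `^ p^-1)%E.

(* Elements are Borel representatives; membership in X0sp is insensitive to
   modifications on a negligible set. *)
Definition Wsp : set (V -> R) :=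
  [set u | u \in Lfun mu p%:E /\ (gagliardo u < +oo)%E].

Definition X0sp (Omega : set V) : set (V -> R) :=
  [set u | Wsp u /\ {ae mu, forall x, ~ Omega x -> u x = 0}].

Definition energy_form u phi : \bar R :=
  (\int[(mu \x mu)%E]_z
     (`|u z.1 - u z.2| `^ (p - 2) * (u z.1 - u z.2) * (phi z.1 - phi z.2)
        / kernel_weight z)%:E)%E.

(* The positive normalization constant of the operator is taken to be 1. *)
Definition weak_solution (Omega : set V) (f : V -> R -> R) u :=
  X0sp Omega u /\
  forall phi, X0sp Omega phi ->
    energy_form u phi = (\int[mu]_(x in Omega) (f x (u x) * phi x)%:E)%E.

Definition critical_exponent : R := p * Q / (Q - p * s).

End fractional_p_sublaplacian.

(* Main.v *)
Require Import Defs.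
From mathcomp Require Import all_boot all_order all_algebra.
From mathcomp Require Import all_classical all_reals all_analysis.
From mathcomp Require Import measurable_realfun ring lra.

Set Implicit Arguments.
Unset Strict Implicit.
Unset Printing Implicit Defensive.

Import Order.TTheory GRing.Theory Num.Theory.
Import numFieldNormedType.Exports.

Local Open Scope classical_set_scope.
Local Open Scope ring_scope.

(** The energy is nonlocal, and this turns constants into barriers. If a function
    that vanishes outside the bounded set [Omega] is cut off at height [M], the
    interaction of [Omega] with a box outside it releases an energy of at least
    [kap * M ^ (p - 1)] times the mass that is cut off ([energy_clip]). Take [M]
    so small that the critical term [M ^ (P - 1)], with [P > p], is half of
    [kap * M ^ (p - 1)], and then [lambda] so small that the other terms of the
    reaction at height [M] stay below the second half. The solution is then a
    minimizer of [energy u / p - \int F(u)], with [F] the primitive of the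
    reaction [f], among the functions with [0 <= u <= M]: up to this height [f]
    is bounded, whatever its growth.

    The minimizer exists without any compactness ([action_minimizer]). The energy
    is submodular: it does not increase, in total, when [u] and [v] are replaced
    by their minimum and their maximum ([energy_minmax]); the potential term does
    not change in total. Hence the maximum of two almost minimizing functions is
    almost minimizing, and the upper limit of a minimizing sequence is a
    minimizer, by two monotone passages to the limit and Fatou's lemma.

    The minimizer solves the equation although it is only compared with functions
    between [0] and [M] ([minimizer_energy_le]): [u + t phi] is clipped to this
    interval, and since [f M <= kap * M ^ (p - 1)] and [f >= 0] on [[0, M]] the
    clipping does not cost anything. Letting [t] go to [0] for [phi] and [- phi]
    gives the weak formulation ([minimizer_variation]). The minimizer is not zero
    because [m < p]: along [eps * v] the term [lambda * u ^ m / m] wins over the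
    energy ([minimizer_neq0]).

    This last step needs one nonzero function [v] of finite energy, for which the
    group enters: [v] is a Lipschitz tent, and the integral is split into dyadic
    shells of the quasi-distance. The volume of a shell is estimated
    through the structure of the group law ([op_triangular]): by homogeneity under
    dilations, the coordinate [i] of [x o y] is [y_i] plus a function of [x] and of
    the coordinates of [y] of smaller weight. A translated quasi-ball is therefore
    a sheared box, up to constants, and has volume [O(t ^ Q)]
    ([quasi_ball_volume]). *)

(** * Convexity of powers *)

Section power_inequalities.
Context {R : realType}.
Implicit Types p r x y : R.

(** Young's inequality, read as the tangent line inequality of a convex power. *)
Lemma powR_tangent r x y : 1 <= r -> 0 <= x -> 0 <= y ->
  r * x `^ (r - 1) * (y - x) <= y `^ r - x `^ r.
Proof.
rewrite le_eqVlt => /predU1P[<-|r1] x0 y0.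
  by rewrite subrr powRr0 !mul1r !powRr1.
have r0 : 0 < r by lra.
have rV : r^-1 + ((r - 1) / r) = 1 by field; lra.
have := @conjugate_powR _ y (x `^ (r - 1)) r ((r - 1) / r)^-1 y0 (powR_ge0 _ _) r0.
rewrite invr_gt0 invrK divr_gt0 ?subr_gt0// => /(_ isT rV).
rewrite -powRrM (_ : (r - 1) * ((r - 1) / r)^-1 = r); last by field; lra.
have <- := mulr_powRB1 x0 r0.
set a := x `^ (r - 1); set b := y `^ r => h.
have : r * (y * a) <= r * (b / r + x * a * ((r - 1) / r)) by rewrite ler_pM2l.
rewrite (_ : r * (b / r + x * a * ((r - 1) / r)) = b + x * a * (r - 1)); last by field; lra.
nra.
Qed.

(** The derivative of [|x| ^ p / p], written as in the weak formulation. *)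
Definition odd_powR p x : R := `|x| `^ (p - 2) * x.

Lemma odd_powRM p x : 2 <= p -> odd_powR p x * x = `|x| `^ p.
Proof.
move=> p2; rewrite /odd_powR -mulrA; have [->|x0] := eqVneq x 0.
  by rewrite mulr0 mulr0 normr0 powR0//; lra.
rewrite -expr2 -real_normK ?num_real// -powR_mulrn// -powRD ?subrK//.
by apply/implyP => _; rewrite normr_eq0.
Qed.

Lemma normr_odd_powR p x : 2 <= p -> `|odd_powR p x| = `|x| `^ (p - 1).
Proof.
move=> p2; rewrite /odd_powR normrM norm_powR// normr_id.
have [->|x0] := eqVneq x 0.
  by rewrite normr0 mulr0 powR0//; lra.
rewrite -[X in _ * X]powRr1// -powRD; last by apply/implyP; rewrite normr_eq0.
by congr (_ `^ _); lra.
Qed.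

Lemma normr_powR_tangent p x y : 2 <= p ->
  p * odd_powR p x * (y - x) <= `|y| `^ p - `|x| `^ p.
Proof.
move=> p2; have p1 : 1 <= p by lra.
apply: le_trans (powR_tangent p1 (normr_ge0 x) (normr_ge0 y)).
rewrite -[leLHS]mulrA -[leRHS]mulrA ler_wpM2l//; first by lra.
rewrite !mulrBr odd_powRM// -(normr_odd_powR x p2).
rewrite lerB//; first by rewrite -normrM ler_norm.
by rewrite -normrM odd_powRM// norm_powR// normr_id.
Qed.

Lemma odd_powR_nondecreasing p x y : 2 <= p -> x <= y ->
  odd_powR p x <= odd_powR p y.
Proof.
move=> p2; rewrite le_eqVlt => /predU1P[->//|xy].
have := normr_powR_tangent x y p2; have := normr_powR_tangent y x p2.
set a := odd_powR p x; set b := odd_powR p y => h1 h2.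
have h : 0 <= p * (y - x) * (b - a) by lra.
by move: h; rewrite pmulr_rge0 ?subr_ge0// mulr_gt0//; lra.
Qed.

(** The sum of the tangent inequalities at [a] and [b], whose increments [c - a]
    and [d - b] are opposite, and the monotonicity of the derivative. *)
Lemma normr_powR_majorize p a b c d : 2 <= p ->
  c <= a <= d -> a + b = c + d ->
  `|a| `^ p + `|b| `^ p <= `|c| `^ p + `|d| `^ p.
Proof.
move=> p2 /andP[ca ad] abcd.
wlog ab : a b ca ad abcd / a <= b.
  move=> wh; have [ab|/ltW ba] := leP a b; first exact: wh.
  by rewrite addrC wh//; lra.
have := normr_powR_tangent a c p2; have := normr_powR_tangent b d p2.
have := odd_powR_nondecreasing p2 ab => m.
rewrite (_ : d - b = a - c); last by lra.
rewrite (_ : c - a = - (a - c)); last by lra.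
have : 0 <= p * ((a - c) * (odd_powR p b - odd_powR p a)).
  by rewrite !mulr_ge0 ?subr_ge0//; lra.
set oa := odd_powR p a; set ob := odd_powR p b; lra.
Qed.

(** When [a1 - b1] and [a2 - b2] have opposite signs, exchanging the values at one
    of the two points brings the two differences closer to each other and keeps
    their sum; otherwise nothing changes. *)
Lemma normr_powR_minmax p a1 a2 b1 b2 : 2 <= p ->
  `|Num.min a1 b1 - Num.min a2 b2| `^ p + `|Num.max a1 b1 - Num.max a2 b2| `^ p
  <= `|a1 - a2| `^ p + `|b1 - b2| `^ p.
Proof.
move=> p2; have [h1|/ltW h1] := leP a1 b1; have [h2|/ltW h2] := leP a2 b2.
- by [].
- by apply: normr_powR_majorize => //; [apply/andP; split|]; lra.
- by rewrite addrC [leRHS]addrC; apply: normr_powR_majorize => //; [apply/andP; split|]; lra.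
- by rewrite addrC.
Qed.

Definition clip (M x : R) : R := Num.min (Num.max x 0) M.

Lemma clip_ge0 M x : 0 <= M -> 0 <= clip M x.
Proof. by move=> M0; rewrite /clip le_min M0 andbT le_max lexx orbT. Qed.

Lemma clip_le M x : clip M x <= M.
Proof. by rewrite /clip ge_min lexx orbT. Qed.

Lemma clip_ge M x : x - Num.max (x - M) 0 <= clip M x.
Proof.
rewrite /clip /Order.min /Order.max.
by do !case: ifPn; rewrite -?leNgt => *; lra.
Qed.

Lemma clip0 M : 0 <= M -> clip M 0 = 0.
Proof. by move=> M0; rewrite /clip maxxx min_l. Qed.

Lemma normr_clipB M x y : `|clip M x - clip M y| <= `|x - y|.
Proof.
have h1 := ler_norm (x - y); have h2 := ler_norm (- (x - y)).
rewrite normrN in h2; rewrite /clip ler_norml.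
rewrite /Order.min /Order.max.
by apply/andP; split; move: h1 h2; set n := `|x - y| => h1 h2;
  do !case: ifPn; rewrite -?leNgt => *; lra.
Qed.

(** The tangent inequality at [M]. Here [x] is the difference of a value with the
    value [0] taken outside the domain. *)
Lemma clip_powR_gain p M x : 2 <= p -> 0 <= M ->
  `|clip M x| `^ p + p * M `^ (p - 1) * Num.max (x - M) 0 <= `|x| `^ p.
Proof.
move=> p2 M0; have p1 : 1 <= p by lra.
have [xM|/ltW Mx] := leP x M.
  rewrite max_r ?subr_le0// mulr0 addr0 ge0_ler_powR ?nnegrE//; first lra.
  by have := normr_clipB M x 0; rewrite clip0// !subr0.
have x0 : 0 <= x by lra.
rewrite max_l ?subr_ge0// /clip max_l// min_r// ger0_norm// ger0_norm//.
by have := powR_tangent p1 M0 x0; lra.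
Qed.

Lemma normr_powR_continuous r : 0 < r -> continuous (fun x : R => `|x| `^ r).
Proof.
move=> r0 x; have [->|x0] := eqVneq x 0.
  rewrite /continuous_at normr0 powR0 ?gt_eqF//; apply/cvgrPdist_lt => e e0.
  have e0' : 0 < e `^ r^-1 by rewrite powR_gt0.
  have /= := @nbhs0_lt R R^o _ e0'; apply: filterS => y ye.
  rewrite sub0r normrN norm_powR// normr_id.
  rewrite (_ : e = (e `^ r^-1) `^ r); last first.
    by rewrite -powRrM mulVf ?gt_eqF// powRr1// ltW.
  by apply: gt0_ltr_powR; rewrite ?nnegrE ?powR_ge0.
apply: (@continuous_comp _ _ _ (fun x : R => `|x|) (@powR R ^~ r)).
  exact: norm_continuous.
apply/differentiable_continuous; rewrite -derivable1_diffP.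
by apply: derivable_powR; rewrite in_itv/= andbT normr_gt0.
Qed.

Lemma odd_powR_continuous p : 2 <= p -> continuous (odd_powR p).
Proof.
rewrite le_eqVlt => /predU1P[<-|p2] x; rewrite /odd_powR.
  rewrite subrr (_ : (fun _ => _) = id) //.
  by apply/funext => y; rewrite powRr0 mul1r.
apply: (@cvgM _ _ _ _ (fun y => `|y| `^ (p - 2)) id); last exact: cvg_id.
by apply: normr_powR_continuous; rewrite subr_gt0.
Qed.

Lemma normr_odd_powRM p (a b : R) : 2 <= p ->
  `|odd_powR p a * b| <= `|a| `^ p + `|b| `^ p.
Proof.
move=> p2; rewrite normrM normr_odd_powR//.
have p0 : 0 < p by lra.
have [ab|/ltW ba] := leP `|a| `|b|.
  apply: (@le_trans _ _ (`|b| `^ p)); last by rewrite lerDr powR_ge0.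
  rewrite -(mulr_powRB1 (normr_ge0 b) p0) mulrC ler_wpM2l//.
  by rewrite ge0_ler_powR ?nnegrE//; lra.
apply: (@le_trans _ _ (`|a| `^ p)); last by rewrite lerDl powR_ge0.
by rewrite -(mulr_powRB1 (normr_ge0 a) p0) mulrC ler_wpM2r// powR_ge0.
Qed.

Lemma normrD_powR p (a b : R) : 0 <= p ->
  `|a + b| `^ p <= 2 `^ p * (`|a| `^ p + `|b| `^ p).
Proof.
move=> p0; apply: (@le_trans _ _ ((2 * Num.max `|a| `|b|) `^ p)).
  rewrite ge0_ler_powR ?nnegrE ?mulr_ge0 ?le_max ?normr_ge0//.
  apply: (le_trans (ler_normD _ _)).
  by rewrite mulr_natl mulr2n lerD// le_max lexx ?orbT.
rewrite powRM ?le_max ?normr_ge0// ler_wpM2l ?powR_ge0//.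
by case: (leP `|a| `|b|) => _; rewrite ?lerDl ?lerDr powR_ge0.
Qed.

End power_inequalities.

(** * Minimization by submodularity *)

(** Lower limits are superadditive; this adds up two instances of Fatou's
    lemma. *)
Lemma limn_einfD_le (R : realType) (a b : (\bar R)^nat) (C : \bar R) :
  (forall n, 0 <= a n)%E -> (forall n, 0 <= b n)%E -> (forall n, a n + b n <= C)%E ->
  (limn_einf a + limn_einf b <= C)%E.
Proof.
move=> a0 b0 abC; rewrite !limn_einf_lim.
have ei0 (u : (\bar R)^nat) n : (forall n, 0 <= u n)%E -> (0 <= einfs u n)%E.
  by move=> u0; apply: le_ereal_inf_tmp => _ [i /= _ <-].
have l0 (u : (\bar R)^nat) : (forall n, 0 <= u n)%E -> (0 <= limn (einfs u))%E.
  move=> u0; apply: lime_ge; first exact: is_cvg_einfs.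
  by apply: nearW => n; exact: ei0.
have cab : (einfs a \+ einfs b @ \oo --> limn (einfs a) + limn (einfs b))%E.
  apply: cvgeD; [|exact: is_cvg_einfs|exact: is_cvg_einfs].
  by apply: ge0_adde_def; rewrite inE l0.
rewrite -(cvg_lim _ cab)//; apply: lime_le; first by apply/cvg_ex; eexists; exact: cab.
apply: nearW => n /=; apply: le_trans (abC n).
by apply: leeD; apply: ereal_inf_lbound; exists n => //=.
Qed.

Section energy.
Context d (T : measurableType d) (R : realType).
Variable mu : {sigma_finite_measure set T -> \bar R}.
Variables (W : T * T -> R) (Omega : set T) (p : R).
Hypotheses (mW : measurable_fun setT W) (W0 : forall z, 0 <= W z).
Hypotheses (mOmega : measurable Omega) (p2 : 2 <= p).
Implicit Types u v : T -> R.

Definition kernel_energy u : \bar R :=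
  (\int[(mu \x mu)%E]_z (`|u z.1 - u z.2| `^ p * W z)%:E)%E.

Lemma measurable_fun_diff u : measurable_fun setT u ->
  measurable_fun setT (fun z : T * T => u z.1 - u z.2).
Proof.
move=> mu_; apply: measurable_funB.
  by apply: (measurableT_comp mu_); exact: measurable_fst.
by apply: (measurableT_comp mu_); exact: measurable_snd.
Qed.

Lemma measurable_energy u : measurable_fun setT u ->
  measurable_fun setT (fun z : T * T => `|u z.1 - u z.2| `^ p * W z).
Proof.
move=> mu_; apply: measurable_funM => //.
apply: (@measurableT_comp _ _ _ _ _ _ (@powR R ^~ p)); first exact: measurable_powR.
by apply: measurableT_comp => //; exact: measurable_fun_diff.
Qed.

Lemma energy_ge0 u : (0 <= kernel_energy u)%E.
Proof. by apply: integral_ge0 => z _; rewrite lee_fin mulr_ge0 ?powR_ge0. Qed.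

(** Submodularity of the energy, which takes the place of compactness in the
    construction of minimizers. *)
Lemma energy_minmax u v : measurable_fun setT u -> measurable_fun setT v ->
  (kernel_energy (u \min v) + kernel_energy (u \max v) <= kernel_energy u + kernel_energy v)%E.
Proof.
move=> mu_ mv.
have mm : measurable_fun setT (u \min v) by exact: measurable_minr.
have mM : measurable_fun setT (u \max v) by exact: measurable_maxr.
have D f g : measurable_fun setT f -> measurable_fun setT g ->
    (kernel_energy f + kernel_energy g = \int[(mu \x mu)%E]_z
      ((`|f z.1 - f z.2| `^ p * W z)%:E + (`|g z.1 - g z.2| `^ p * W z)%:E))%E.
  move=> mf mg; rewrite /kernel_energy ge0_integralD//.
  - by move=> *; rewrite lee_fin mulr_ge0 ?powR_ge0.
  - by apply/measurable_EFinP; exact: measurable_energy.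
  - by move=> *; rewrite lee_fin mulr_ge0 ?powR_ge0.
  - by apply/measurable_EFinP; exact: measurable_energy.
have tr (a b c e : \bar R) : (a = b -> c = e -> b <= e -> a <= c)%E by move=> -> ->.
apply: (tr _ _ _ _ (D _ _ mm mM) (D _ _ mu_ mv)).
apply: ge0_le_integral.
- exact: measurableT.
- by move=> *; rewrite adde_ge0// lee_fin mulr_ge0 ?powR_ge0.
- by apply: emeasurable_funD; apply/measurable_EFinP; exact: measurable_energy.
- by apply: emeasurable_funD; apply/measurable_EFinP; exact: measurable_energy.
move=> z _; rewrite -!EFinD lee_fin -!mulrDl ler_wpM2r//.
exact: normr_powR_minmax.
Qed.

Variables (Phi : R -> R) (M : R).
Hypotheses (Phi_cont : continuous Phi) (M0 : 0 <= M).
Hypotheses (Phi0 : forall t, 0 <= t <= M -> 0 <= Phi t).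

Definition between u := [/\ measurable_fun setT u, forall x, 0 <= u x <= M &
  forall x, ~ Omega x -> u x = 0].

(** For [Phi t = p * (F M - F t)] this is [p * (energy u / p - \int F(u))] up to an
    additive constant. Both terms are nonnegative, so that Fatou's lemma applies
    to each of them. *)
Definition action u : \bar R :=
  (kernel_energy u + \int[mu]_(x in Omega) (Phi (u x))%:E)%E.

Lemma between0 : between (fun=> 0).
Proof. by split => // x; rewrite lexx. Qed.

Lemma between_min u v : between u -> between v -> between (u \min v).
Proof.
move=> [mu_ uM u0] [mv vM v0]; split => [|x|x Ox]; first exact: measurable_minr.
  have := uM x; have := vM x => /andP[? ?] /andP[? ?].
  by rewrite le_min ge_min; apply/andP; split; [apply/andP|apply/orP; left].
by rewrite /= u0// v0// minxx.
Qed.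

Lemma between_max u v : between u -> between v -> between (u \max v).
Proof.
move=> [mu_ uM u0] [mv vM v0]; split => [|x|x Ox]; first exact: measurable_maxr.
  have := uM x; have := vM x => /andP[? ?] /andP[? ?].
  by rewrite le_max ge_max; apply/andP; split; [apply/orP; left|apply/andP].
by rewrite /= u0// v0// maxxx.
Qed.

Lemma between_cvg (u_ : (T -> R)^nat) u : (forall n, between (u_ n)) ->
  (forall x, u_ ^~ x @ \oo --> u x) -> between u.
Proof.
move=> bu uu; split => [|x|x Ox].
- apply: (@measurable_fun_cvg _ _ _ setT u_) => // m.
  by have [] := bu m.
- have cu : cvgn (u_ ^~ x) by apply/cvg_ex; exists (u x); exact: uu.
  have <- := cvg_lim _ (uu x) => //.
  apply/andP; split; [apply: limr_ge => //|apply: limr_le => //];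
    by apply: nearW => n; have [_ /(_ x)/andP[]] := bu n.
- have h := uu x; suff : (fun n => u_ n x) = cst 0.
    by move=> e; move: h; rewrite e => h; have <- := cvg_lim _ h => //; rewrite lim_cst.
  by apply/funext => n; have [_ _ /(_ x Ox)] := bu n.
Qed.

Lemma measurable_potential u : between u ->
  measurable_fun Omega (fun x => (Phi (u x))%:E).
Proof.
move=> [mu_ _ _]; apply/measurable_EFinP; apply: measurable_funTS.
by apply: measurableT_comp => //; exact: continuous_measurable_fun.
Qed.

Lemma action_ge0 u : between u -> (0 <= action u)%E.
Proof.
move=> [_ uM _]; rewrite adde_ge0 ?energy_ge0//.
by apply: integral_ge0 => x _; rewrite lee_fin Phi0.
Qed.

(** The potential term is modular: at each point the minimum and the maximum are
    the two values [u x] and [v x] in some order. *)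
Lemma action_minmax u v : between u -> between v ->
  (action (u \min v) + action (u \max v) <= action u + action v)%E.
Proof.
move=> bu bv; have bm := between_min bu bv; have bM := between_max bu bv.
have mm : forall w, between w -> measurable_fun setT w by move=> w [].
have Pge : forall w, between w -> forall x, Omega x -> (0 <= (Phi (w x))%:E)%E.
  by move=> w [_ wM _] x _; rewrite lee_fin Phi0.
have key : (\int[mu]_(x in Omega) (Phi ((u \min v) x))%:E +
    \int[mu]_(x in Omega) (Phi ((u \max v) x))%:E =
  \int[mu]_(x in Omega) (Phi (u x))%:E + \int[mu]_(x in Omega) (Phi (v x))%:E)%E.
  rewrite -!ge0_integralD//; try by [exact: Pge|exact: measurable_potential].
  apply: eq_integral => x _ /=; case: (leP (u x) (v x)) => _ //.
  by rewrite addeC.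
have [mfu mfv] := (mm _ bu, mm _ bv).
have cross (a b c e a' b' c' e' : \bar R) : (a + c <= a' + c')%E ->
    (b + e = b' + e')%E -> (a + b + (c + e) <= a' + b' + (c' + e'))%E.
  by move=> h k; rewrite addeACA k [leRHS]addeACA leeD2r.
by apply: cross key; exact: energy_minmax.
Qed.

Lemma action_fatou (u_ : (T -> R)^nat) u (C : \bar R) :
  (forall n, between (u_ n)) -> (forall x, u_ ^~ x @ \oo --> u x) ->
  (forall n, action (u_ n) <= C)%E -> (action u <= C)%E.
Proof.
move=> bu uu uC; have bu' := between_cvg bu uu.
have h (X Y : \bar R) f g : (X <= limn_einf f)%E -> (Y <= limn_einf g)%E ->
    (limn_einf f + limn_einf g <= C)%E -> (X + Y <= C)%E.
  by move=> ? ?; apply: le_trans; exact: leeD.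
apply: (h _ _ (fun n => kernel_energy (u_ n))
    (fun n => (\int[mu]_(x in Omega) (Phi (u_ n x))%:E)%E)).
- rewrite /kernel_energy; under eq_integral => z _.
    rewrite (_ : (_)%:E = limn_einf (fun n => (`|u_ n z.1 - u_ n z.2| `^ p * W z)%:E)).
      over.
    apply/esym; apply: (cvg_limn_einf_sup _).1; apply: cvg_EFin; first exact: nearW.
    apply: cvgMl; apply: (@continuous_cvg _ _ _ _ _ _ (fun t : R => `|t| `^ p)).
      by apply: normr_powR_continuous; exact: (lt_le_trans (ltr0Sn _ 1) p2).
    by apply: cvgB; exact: uu.
  apply: fatou => //.
    by move=> n; apply/measurable_EFinP; apply: measurable_energy; have [] := bu n.
  by move=> n z _; rewrite lee_fin mulr_ge0 ?powR_ge0.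
- under eq_integral => x _.
    rewrite (_ : (_)%:E = limn_einf (fun n => (Phi (u_ n x))%:E)).
      over.
    apply/esym; apply: (cvg_limn_einf_sup _).1; apply: cvg_EFin; first exact: nearW.
    by apply: continuous_cvg => //; exact: Phi_cont.
  apply: fatou => //; first by move=> n; exact: measurable_potential.
  by move=> n x _; rewrite lee_fin Phi0//; have [_ ->] := bu n.
apply: limn_einfD_le => // n; first exact: energy_ge0.
by apply: integral_ge0 => x _; rewrite lee_fin Phi0//; have [_ ->] := bu n.
Qed.

(** The upper limit of [v] is the decreasing limit in [j] of the increasing limit
    in [l] of these functions, so that every passage to the limit is pointwise. *)
Fixpoint tail_max (v : (T -> R)^nat) j l : T -> R :=
  if l is l'.+1 then tail_max v j l' \max v (j + l)%N else v j.

(** The upper limit of a sequence [v] with [action (v j) <= inf + 2 ^- j] is a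
    minimizer. By submodularity, replacing [V] by [V \max v_i] raises the action
    by at most [action v_i - action (V \min v_i)]; the minimum being admissible,
    this is at most [2 ^- i]. The maxima over the tail from [j] on are thus within
    [2 * 2 ^- j] of the infimum, and so are their limits. *)
Lemma action_minimizer : (action (fun=> 0%R) < +oo)%E ->
  exists2 u, between u & forall v, between v -> (action u <= action v)%E.
Proof.
move=> J0; set S := [set action v | v in between].
have infS v : between v -> (ereal_inf S <= action v)%E.
  by move=> bv; apply: ereal_inf_lbound; exists v.
have fin : ereal_inf S \is a fin_num.
  rewrite ge0_fin_numE; first exact: le_lt_trans (infS _ between0) J0.
  by apply: le_ereal_inf_tmp => _ [v bv <-]; exact: action_ge0.
pose r := fine (ereal_inf S); have rE : ereal_inf S = r%:E by rewrite fineK.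
pose e (j : nat) : R := 2^-1 ^+ j.
have e_gt0 j : 0 < e j by rewrite exprn_gt0.
have eS j : e j.+1 = e j / 2 by rewrite /e exprS mulrC.
have /choice[v hv] : forall j, exists v, between v /\ (action v <= (r + e j)%:E)%E.
  move=> j; have [_ [v bv <-] h] := lb_ereal_inf_adherent (e_gt0 j) fin.
  by exists v; split => //; rewrite EFinD -rE; exact: ltW.
have bv j : between (v j) by case: (hv j).
pose V := tail_max v.
have bV j l : between (V j l).
  by elim: l => [|l IH]; [apply: (bv j)|apply: (between_max IH (bv _))].
have JV j l : (action (V j l) <= (r + 2 * e j - e (j + l)%N)%:E)%E.
  elim: l => [|l IH].
    by apply: le_trans (hv j).2 _; rewrite lee_fin addn0; lra.
  have := action_minmax (bV j l) (bv (j + l.+1)%N).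
  rewrite -/(V j l.+1) => h.
  have h1 : (r%:E <= action (V j l \min v (j + l.+1)%N)%R)%E.
    by rewrite -rE; apply: infS; exact: between_min.
  have := le_trans (leeD h1 (lexx (action (V j l.+1)))) h.
  move=> /le_trans/(_ (leeD IH (hv _).2)); rewrite -EFinD -leeBrDl//.
  move=> /le_trans; apply; rewrite -EFinB lee_fin addnS eS; lra.
have ndV j x : nondecreasing_seq (fun l => V j l x).
  by apply/nondecreasing_seqP => l /=; rewrite le_max lexx.
have cV j x : cvgn (fun l => V j l x).
  apply: nondecreasing_is_cvgn; first exact: ndV.
  by exists M => _ [l _ <-]; have [_ /(_ x)/andP[]] := bV j l.
pose U j x := limn (fun l => V j l x).
have VU j x : (fun l => V j l x) @ \oo --> U j x by exact: cV.
have bU j : between (U j) by apply: (between_cvg (bV j)) => x; exact: VU.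
have JU j : (action (U j) <= (r + 2 * e j)%:E)%E.
  apply: (action_fatou (bV j)) => [x|l]; first exact: VU.
  by apply: le_trans (JV j l) _; rewrite lee_fin; have := e_gt0 (j + l)%N; lra.
have VS j l x : V j.+1 l x <= V j l.+1 x.
  rewrite /V; elim: l => [|l IH] /=; first by rewrite addnS addn0 le_max lexx orbT.
  rewrite ge_max; apply/andP; split; rewrite le_max.
    by apply/orP; left; exact: IH.
  by rewrite addSnnS lexx orbT.
have niU x : nonincreasing_seq (U ^~ x).
  apply/nonincreasing_seqP => j; apply: limr_le; first exact: cV.
  apply: nearW => l; apply: le_trans (VS j l x) _.
  exact: (nondecreasing_cvgn_le (ndV j x) (cV j x) l.+1).
have cU x : cvgn (U ^~ x).
  apply: nonincreasing_is_cvgn; first exact: niU.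
  by exists 0 => _ [l _ <-]; have [_ /(_ x)/andP[]] := bU l.
pose u x := limn (U ^~ x).
have bu : between u by apply: (between_cvg bU) => x; exact: cU.
exists u => // w /infS; apply: le_trans; rewrite rE.
apply/lee_addgt0Pr => eps eps0.
have [j ej] : exists j, 2 * e j <= eps.
  have : e j @[j --> \oo] --> (0 : R) by apply: cvg_expr; rewrite ger0_norm; lra.
  have e2 : 0 < eps / 2 by lra.
  move=> /cvgrPdist_le/(_ _ e2)[j _ /(_ j (leqnn _))]; rewrite sub0r normrN.
  by rewrite ger0_norm ?(ltW (e_gt0 _))// => h; exists j; lra.
apply: (@le_trans _ _ (r + 2 * e j)%:E); last by rewrite -EFinD lee_fin; lra.
apply: (@action_fatou (fun i => U (i + j)%N)) => [//|x|i].
  by rewrite (cvg_shiftn j (U ^~ x)); exact: cU.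
apply: le_trans (JU _) _; rewrite lee_fin lerD2l ler_wpM2l// /e exprD.
by rewrite ler_piMl ?exprn_ge0// exprn_ile1//; lra.
Qed.

End energy.

(** * The Euler-Lagrange equation *)

(** The real terms of an inequality between energies cancel, whether or not the
    energies [y] and [z] are finite. *)
Lemma ereal_cancel (R : realType) (x y z : \bar R) (a a' b c e : R) :
  (0 <= x < +oo)%E -> (0 <= y)%E -> (0 <= z)%E ->
  (x + a%:E <= y + a'%:E)%E -> (y + c%:E <= z)%E -> a' + b <= a + e -> e <= c ->
  (x + b%:E <= z)%E.
Proof.
move: x y z => [x| |] [y| |] [z| |]//=; rewrite ?leey// -!EFinD !lee_fin => *; lra.
Qed.

Section euler_lagrange.
Context d (T : measurableType d) (R : realType).
Variable mu : {sigma_finite_measure set T -> \bar R}.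
Variables (W : T * T -> R) (Omega : set T) (p : R).
Hypotheses (mW : measurable_fun setT W) (W0 : forall z, 0 <= W z).
Hypotheses (mOmega : measurable Omega) (p2 : 2 <= p).
Implicit Types u v phi : T -> R.
Local Notation energy := (kernel_energy mu W p).
Local Notation mu2 := (mu \x mu)%E.

Lemma integrable_energy u : measurable_fun setT u -> (energy u < +oo)%E ->
  mu2.-integrable setT (EFin \o (fun z => `|u z.1 - u z.2| `^ p * W z)).
Proof.
move=> mu_ Eu; apply/integrableP; split.
  by apply/measurable_EFinP; exact: measurable_energy.
rewrite (eq_integral (fun z => (`|u z.1 - u z.2| `^ p * W z)%:E))// => z _.
by rewrite /= ger0_norm ?mulr_ge0 ?powR_ge0.
Qed.

Lemma energyDZ_lty u phi t : measurable_fun setT u -> measurable_fun setT phi ->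
  (energy u < +oo)%E -> (energy phi < +oo)%E ->
  (energy (fun x => u x + t * phi x)%R < +oo)%E.
Proof.
move=> mu_ mphi Eu Ephi.
pose g z := 2 `^ p * (`|u z.1 - u z.2| `^ p * W z) +
  2 `^ p * `|t| `^ p * (`|phi z.1 - phi z.2| `^ p * W z).
have ig : mu2.-integrable setT (EFin \o g).
  rewrite /g (_ : EFin \o _ = (fun z => ((2 `^ p)%:E * (`|u z.1 - u z.2| `^ p * W z)%:E) +
     ((2 `^ p * `|t| `^ p)%:E * (`|phi z.1 - phi z.2| `^ p * W z)%:E)))%E//.
  by apply: integrableD => //; apply: integrableZl => //; exact: integrable_energy.
apply: (@le_lt_trans _ _ (\int[mu2]_z (g z)%:E)%E); last exact: (integrable_lty measurableT ig).
have mv : measurable_fun setT (fun x => u x + t * phi x).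
  by apply: measurable_funD => //; exact: measurable_funM.
apply: ge0_le_integral => //.
- by move=> z _; rewrite lee_fin mulr_ge0 ?powR_ge0.
- by apply/measurable_EFinP; exact: (measurable_energy p mW mv).
- exact: measurable_int ig.
move=> z _; rewrite lee_fin /g !mulrA -mulrDl ler_wpM2r//.
rewrite (_ : u z.1 + _ - _ = (u z.1 - u z.2) + t * (phi z.1 - phi z.2)); last by ring.
have p0 : 0 <= p by have := p2; lra.
apply: le_trans (normrD_powR _ _ p0) _.
by rewrite normrM powRM// mulrDr mulrA.
Qed.

(** The derivative at [t = 0] of the energy of [u + t phi] is [p] times the integral
    of this function. *)
Definition energy_variation u phi (z : T * T) : R :=
  odd_powR p (u z.1 - u z.2) * (phi z.1 - phi z.2) * W z.

Lemma measurable_energy_variation u phi :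
  measurable_fun setT u -> measurable_fun setT phi ->
  measurable_fun setT (energy_variation u phi).
Proof.
move=> mu_ mphi; apply: measurable_funM => //; apply: measurable_funM.
  apply: (@measurableT_comp _ _ _ _ _ _ (odd_powR p)).
    by apply: continuous_measurable_fun; exact: odd_powR_continuous.
  exact: measurable_fun_diff.
exact: measurable_fun_diff.
Qed.

Lemma integrable_energy_variation u phi :
  measurable_fun setT u -> measurable_fun setT phi ->
  (energy u < +oo)%E -> (energy phi < +oo)%E ->
  mu2.-integrable setT (EFin \o energy_variation u phi).
Proof.
move=> mu_ mphi Eu Ephi; have iu := integrable_energy mu_ Eu.
have iphi := integrable_energy mphi Ephi.
apply: (le_integrable measurableT _ _ (integrableD measurableT iu iphi)) => //=.
  by apply/measurable_EFinP; exact: measurable_energy_variation.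
move=> z _; rewrite lee_fin -mulrDl.
rewrite [leRHS]ger0_norm ?mulr_ge0 ?addr_ge0 ?powR_ge0//.
by rewrite normrM (ger0_norm (W0 _)) ler_wpM2r// normr_odd_powRM.
Qed.

Variables (F f : R -> R) (M : R) (B : set T) (b kap : R).
Hypotheses (F_cont : continuous F) (M0 : 0 <= M).
Hypothesis F_le : forall t, 0 <= t <= M -> F t <= F M.
Hypothesis F_tangent : forall s t, 0 <= s <= M -> 0 <= t <= M ->
  f s * (t - s) <= F t - F s.
Hypothesis mf : measurable_fun setT f.
Hypothesis f0 : forall t, 0 <= t <= M -> 0 <= f t <= f M.
Hypotheses (mB : measurable B) (muB : mu B = b%:E) (kap0 : 0 <= kap).
Hypothesis OmegaB : forall x, Omega x -> ~ B x.
Hypothesis W_ge : forall x y, Omega x -> B y -> kap <= W (x, y).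
Hypothesis fM : f M <= kap * b * M `^ (p - 1).
Hypothesis muOmega : (mu Omega < +oo)%E.

Let Phi t := p * (F M - F t).

Let Phi_cont : continuous Phi.
Proof.
move=> t; apply: cvgMr; apply: cvgB; [exact: cvg_cst|exact: F_cont].
Qed.

Let Phi0 t : 0 <= t <= M -> 0 <= Phi t.
Proof. by move=> /F_le h; rewrite mulr_ge0 ?subr_ge0//; have := p2; lra. Qed.

Let b0 : 0 <= b. Proof. by rewrite -lee_fin -muB. Qed.

Let measurable_clip v : measurable_fun setT v -> measurable_fun setT (clip M \o v).
Proof.
move=> mv; apply: (@measurable_minr _ _ _ _ (fun x => Num.max (v x) 0) (cst M)) => //.
exact: (@measurable_maxr _ _ _ _ v (cst 0)).
Qed.

(** The constant [M] is a barrier: [v] vanishes on [B], so that at each point of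
    [Omega] the interaction with [B] alone, of weight at least [kap * b], saves the
    gain of [clip_powR_gain]. *)
Lemma energy_clip v : measurable_fun setT v -> (forall x, ~ Omega x -> v x = 0) ->
  (energy (clip M \o v) +
    \int[mu]_(x in Omega)
       (p * (kap * b * M `^ (p - 1)) * Num.max (v x - M) 0)%:E <= energy v)%E.
Proof.
move=> mv v0.
have mc := measurable_clip mv.
have me : measurable_fun setT (fun x => Num.max (v x - M) 0).
  by apply: (@measurable_maxr _ _ _ _ (fun x => v x - M) (cst 0)) => //; exact: measurable_funB.
pose c := p * M `^ (p - 1) * kap.
have c0 : 0 <= c by rewrite /c !mulr_ge0 ?powR_ge0//; have := p2; lra.
pose g (z : T * T) := c * Num.max (v z.1 - M) 0 * \1_B z.2.
have g0 z : 0 <= g z.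
  rewrite /g; apply: mulr_ge0; last by rewrite indicE ler0n.
  by apply: mulr_ge0 => //; rewrite le_max lexx orbT.
have mg : measurable_fun setT g.
  apply: measurable_funM.
    apply: measurable_funM => //.
    by apply: (measurableT_comp me); exact: measurable_fst.
  by apply: measurableT_comp => //; exact: measurable_snd.
have -> : (\int[mu]_(x in Omega)
    (p * (kap * b * M `^ (p - 1)) * Num.max (v x - M) 0)%:E =
    \int[mu2]_z (g z)%:E)%E.
  rewrite fubini_tonelli1//; last by apply/measurable_EFinP.
  rewrite integral_mkcond; apply: eq_integral => x _ /=.
  rewrite /fubini_F /g /= patchE; case: ifPn => [/set_mem|/negP] Ox.
    under eq_integral do rewrite EFinM.
    rewrite ge0_integralZl//.
    - rewrite integral_indic// setIT [X in (_ * X)%E](_ : _ = b%:E); last exact: muB.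
      by rewrite -EFinM; congr EFin; rewrite /c; ring.
    - by apply/measurable_EFinP.
    - by rewrite lee_fin mulr_ge0// le_max lexx orbT.
  have -> : v x = 0 by apply: v0 => /mem_set.
  rewrite max_r ?sub0r ?oppr_le0// mulr0.
  by under eq_integral do rewrite mul0r; rewrite integral0.
rewrite /kernel_energy -ge0_integralD//; last 4 first.
- by move=> *; rewrite lee_fin mulr_ge0 ?powR_ge0.
- by apply/measurable_EFinP; exact: measurable_energy.
- by move=> *; rewrite lee_fin.
- by apply/measurable_EFinP.
apply: ge0_le_integral.
- exact: measurableT.
- by move=> *; rewrite adde_ge0// lee_fin// mulr_ge0 ?powR_ge0.
- apply: emeasurable_funD; apply/measurable_EFinP => //; exact: measurable_energy.
- by apply/measurable_EFinP; exact: measurable_energy.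
move=> [x y] _; rewrite -EFinD lee_fin /g /=.
have lip : `|clip M (v x) - clip M (v y)| `^ p * W (x, y) <=
    `|v x - v y| `^ p * W (x, y).
  by rewrite ler_wpM2r// ge0_ler_powR ?nnegrE ?normr_clipB//; have := p2; lra.
rewrite indicE; case: (boolP (y \in B)) => [/set_mem By|_]; last by rewrite mulr0 addr0.
rewrite mulr1; case: (pselect (Omega x)) => Ox; last first.
  by rewrite (v0 x Ox) sub0r max_r ?oppr_le0// mulr0 addr0 -(v0 x Ox).
have vy0 : v y = 0 by apply: v0 => Oy; exact: (OmegaB Oy).
rewrite vy0 clip0// !subr0.
have := clip_powR_gain (v x) p2 M0; set e := Num.max _ _ => h.
have e0 : 0 <= e by rewrite le_max lexx orbT.
apply: le_trans (_ : (`|clip M (v x)| `^ p + p * M `^ (p - 1) * e) * W (x, y) <= _).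
  rewrite mulrDl lerD2l /c -!mulrA ler_wpM2l//; first by have := p2; lra.
  rewrite ler_wpM2l ?powR_ge0// mulrC ler_wpM2l//; exact: W_ge.
by rewrite ler_wpM2r.
Qed.

Local Notation action := (action mu W Omega p Phi).
Local Notation between := (between Omega M).

Lemma integrable_bounded (h : T -> R) (c : R) : measurable_fun Omega h ->
  (forall x, Omega x -> `|h x| <= c) -> mu.-integrable Omega (EFin \o h).
Proof.
move=> mh hc; apply: measurable_bounded_integrable => //.
exists c; split; first exact: num_real.
by move=> x cx y Oy /=; apply: le_trans (hc _ Oy) (ltW cx).
Qed.

Let zero_in : (0 : R) <= 0 <= M. Proof. by rewrite lexx M0. Qed.

Let Phi_le t : 0 <= t <= M -> Phi t <= Phi 0.
Proof.
move=> tM; rewrite /Phi ler_wpM2l//; first by have := p2; lra.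
have := F_tangent zero_in tM; rewrite subr0 => h.
have /andP[f00 _] := f0 zero_in; have /andP[t0 _] := tM.
have : 0 <= f 0 * t by rewrite mulr_ge0.
lra.
Qed.

Lemma integrable_potential u : between u -> mu.-integrable Omega (EFin \o (Phi \o u)).
Proof.
move=> bu; apply: (@integrable_bounded _ (Phi 0)).
  by apply/measurable_EFinP; by apply: measurable_potential => //; exact: bu.
by move=> x Ox; have [_ uM _] := bu; rewrite ger0_norm ?Phi0// Phi_le.
Qed.

Lemma integrable_reaction u phi : between u -> measurable_fun setT phi ->
  mu.-integrable Omega (EFin \o phi) ->
  mu.-integrable Omega (EFin \o (fun x => f (u x) * phi x)).
Proof.
move=> [mu_ uM u0] mphi iphi.
have iabs : mu.-integrable Omega (EFin \o (fun x => `|phi x|)) by exact: integrable_norm iphi.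
apply: (le_integrable mOmega _ _ (integrableZl mOmega (f M) iabs)).
  apply/measurable_EFinP; apply: measurable_funTS; apply: measurable_funM => //.
  exact: measurableT_comp.
move=> x _ /=; rewrite lee_fin; apply: le_trans (ler_norm _).
by rewrite normrM ler_wpM2r//; have /andP[h1 h2] := f0 (uM x); rewrite ger0_norm.
Qed.

Lemma energy_zero : energy (fun=> 0%R) = 0%E.
Proof.
rewrite /kernel_energy; under eq_integral do
  rewrite subrr normr0 powR0 ?mul0r ?gt_eqF ?(lt_le_trans _ p2)//.
by rewrite integral0.
Qed.

Lemma action_zero_lty : (action (fun=> 0%R) < +oo)%E.
Proof.
rewrite /action energy_zero add0e.
exact: (integrable_lty mOmega (integrable_potential (between0 Omega M0))).
Qed.

Lemma energy_minimizer_lty u : between u ->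
  (forall v, between v -> (action u <= action v)%E) -> (energy u < +oo)%E.
Proof.
move=> bu umin; apply: le_lt_trans action_zero_lty.
apply: le_trans (umin _ (between0 Omega M0)).
rewrite leeDl// integral_ge0// => x _; rewrite lee_fin Phi0//.
by have [_ ->] := bu.
Qed.

(** Comparison of [u] with the clipped function [clip M (u + t phi)]. The convexity
    of [F] bounds the change of the potential term by [- t f(u) phi] plus [f(u)]
    times the mass cut off above [M], because [f >= 0] makes the clipping at [0]
    favorable. As [f(u) <= f M], the gain of [energy_clip] absorbs the second
    term. *)
Lemma minimizer_energy_le u phi t : between u ->
  (forall v, between v -> (action u <= action v)%E) ->
  measurable_fun setT phi -> (forall x, ~ Omega x -> phi x = 0) ->
  mu.-integrable Omega (EFin \o phi) -> 0 < t ->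
  (energy u + (p * t * \int[mu]_(x in Omega) (f (u x) * phi x))%R%:E <=
   energy (fun x => u x + t * phi x)%R)%E.
Proof.
move=> bu umin mphi phi0 iphi t0; have [mu_ uM u0] := bu.
pose v x := u x + t * phi x; rewrite -/v.
have mv : measurable_fun setT v by apply: measurable_funD => //; exact: measurable_funM.
have v0 x : ~ Omega x -> v x = 0 by move=> Ox; rewrite /v u0// phi0// mulr0 addr0.
pose w := clip M \o v; pose e x := Num.max (v x - M) 0.
have bw : between w.
  split => [|x|x Ox]; first exact: measurable_clip.
    by rewrite /w/= clip_ge0//= clip_le.
  by rewrite /w/= v0// clip0.
have me : measurable_fun setT e.
  by apply: (@measurable_maxr _ _ _ _ (fun x => v x - M) (cst 0)) => //; exact: measurable_funB.
have iabs : mu.-integrable Omega (EFin \o (fun x => `|phi x|)) by exact: integrable_norm iphi.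
have e_le x : `|e x| <= t * `|phi x|.
  have tp : t * phi x <= t * `|phi x| by rewrite ler_wpM2l ?ler_norm// ltW.
  have tp0 : 0 <= t * `|phi x| by rewrite mulr_ge0// ltW.
  rewrite ger0_norm ?le_max ?lexx ?orbT// /e ge_max tp0 andbT /v.
  by have /andP[_ ?] := uM x; lra.
have ie : mu.-integrable Omega (EFin \o e).
  apply: (le_integrable mOmega _ _ (integrableZl mOmega t iabs)).
    by apply/measurable_EFinP; exact: measurable_funTS.
  move=> x _ /=; rewrite lee_fin; apply: le_trans (e_le x) _.
  exact: ler_norm.
have ifphi := integrable_reaction bu mphi iphi.
have iw := integrable_potential bw; have iu := integrable_potential bu.
have iZ h c : mu.-integrable Omega (EFin \o h) -> mu.-integrable Omega (EFin \o (fun x => c * h x)).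
  by move=> ih; have := integrableZl mOmega c ih; apply: eq_integrable.
have iD h k : mu.-integrable Omega (EFin \o h) -> mu.-integrable Omega (EFin \o k) ->
    mu.-integrable Omega (EFin \o (fun x => h x + k x)).
  by move=> ih ik; have := integrableD mOmega ih ik; apply: eq_integrable.
pose a := \int[mu]_(x in Omega) Phi (u x); pose a' := \int[mu]_(x in Omega) Phi (w x).
pose I := \int[mu]_(x in Omega) (f (u x) * phi x).
pose eps := \int[mu]_(x in Omega) e x.
have step3 : a' + p * t * I <= a + p * f M * eps.
  rewrite /a /a' /I /eps -!RintegralZl// -!RintegralD//; try exact: iZ.
  apply: le_Rintegral => //.
  - exact: (iD _ _ iw (iZ _ _ ifphi)).
  - exact: (iD _ _ iu (iZ _ _ ie)).
  move=> x _ /=; have wM : 0 <= w x <= M by have [_ ->] := bw.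
  have hF := F_tangent (uM x) wM; have /andP[fu0 fuM] := f0 (uM x).
  have e0 : 0 <= e x by rewrite /e le_max lexx orbT.
  have we : v x - e x <= w x by exact: clip_ge.
  have h1 : f (u x) * (t * phi x - e x) <= f (u x) * (w x - u x).
    by rewrite ler_wpM2l//; move: we; rewrite /v; lra.
  have h2 : f (u x) * e x <= f M * e x by rewrite ler_wpM2r.
  have h3 : t * (f (u x) * phi x) <= F (w x) - F (u x) + f M * e x by lra.
  have : p * (t * (f (u x) * phi x)) <= p * (F (w x) - F (u x) + f M * e x).
    by rewrite ler_wpM2l//; have := p2; lra.
  rewrite /Phi; lra.
have E h : mu.-integrable Omega (EFin \o h) ->
    (\int[mu]_(x in Omega) (h x)%:E)%E = (\int[mu]_(x in Omega) h x)%:E.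
  by move=> ih; rewrite fineK//; exact: integrable_fin_num.
have step2 := umin _ bw; rewrite /action (E _ iu) (E _ iw) in step2.
have step1 := energy_clip mv v0.
rewrite (E _ (iZ _ _ ie)) RintegralZl// -/eps -/w in step1.
have Eu := energy_minimizer_lty bu umin.
have k : p * f M * eps <= p * (kap * b * M `^ (p - 1)) * eps.
  rewrite ler_wpM2r//.
    by apply: Rintegral_ge0 => x _; rewrite /e le_max lexx orbT.
  by rewrite ler_wpM2l//; have := p2; lra.
have Eu0 : (0 <= energy u < +oo)%E by apply/andP; split; [exact: energy_ge0|exact: Eu].
exact: (ereal_cancel Eu0 (energy_ge0 mu p W0 w) (energy_ge0 mu p W0 v) step2 step1 step3 k).
Qed.

(** The tangent is taken at [u + t phi] in order to bound the increment of the
    energy from above. *)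
Lemma energy_le_variation u phi t : measurable_fun setT u -> measurable_fun setT phi ->
  (energy u < +oo)%E -> (energy phi < +oo)%E ->
  (energy (fun x => u x + t * phi x)%R <= energy u +
    (p * t * \int[mu2]_z energy_variation (fun x => u x + t * phi x) phi z)%R%:E)%E.
Proof.
move=> mu_ mphi Eu Ephi; pose v x := u x + t * phi x; rewrite -/v.
have mv : measurable_fun setT v by apply: measurable_funD => //; exact: measurable_funM.
have Ev : (energy v < +oo)%E by exact: energyDZ_lty.
have iu := integrable_energy mu_ Eu; have iv := integrable_energy mv Ev.
have ivar := integrable_energy_variation mv mphi Ev Ephi.
have iZ : mu2.-integrable setT
    (EFin \o (fun z => p * t * energy_variation v phi z)).
  by have := integrableZl measurableT (p * t) ivar; apply: eq_integrable.
rewrite -RintegralZl//.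
have E h : mu2.-integrable setT (EFin \o h) ->
    (\int[mu2]_z h z)%R%:E = (\int[mu2]_z (h z)%:E)%E.
  by move=> ih; rewrite fineK//; exact: integrable_fin_num.
rewrite (E _ iZ) /kernel_energy -(integralD_EFin measurableT iu iZ).
apply: (le_integral measurableT iv (integrableD measurableT iu iZ)) => z _ /=.
rewrite lee_fin /energy_variation.
have := normr_powR_tangent (v z.1 - v z.2) (u z.1 - u z.2) p2.
rewrite (_ : (u z.1 - u z.2) - (v z.1 - v z.2) = - (t * (phi z.1 - phi z.2))); last first.
  by rewrite /v; ring.
move: (odd_powR p _) => o h.
by rewrite !mulrA -mulrDl ler_wpM2r//; lra.
Qed.

Lemma energy_variation_cvg u phi : measurable_fun setT u -> measurable_fun setT phi ->
  (energy u < +oo)%E -> (energy phi < +oo)%E ->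
  (\int[mu2]_z (energy_variation (fun x => (u x + n.+1%:R^-1 * phi x)%R) phi z)%:E)%E
    @[n --> \oo] --> (\int[mu2]_z (energy_variation u phi z)%:E)%E.
Proof.
move=> mu_ mphi Eu Ephi.
pose U (n : nat) x := u x + n.+1%:R^-1 * phi x.
have mU n : measurable_fun setT (U n) by apply: measurable_funD => //; exact: measurable_funM.
pose e (w : T -> R) (z : T * T) := `|w z.1 - w z.2| `^ p * W z.
have ie w : measurable_fun setT w -> (energy w < +oo)%E ->
  mu2.-integrable setT (EFin \o e w) by exact: integrable_energy.
pose g z := ((2 `^ p)%:E * (e u z)%:E + (2 `^ p + 1)%:E * (e phi z)%:E)%E.
have ig : mu2.-integrable setT g.
  by apply: integrableD => //; apply: integrableZl => //; exact: ie.
have [] := @dominated_convergence _ _ _ mu2 setT measurableT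
  (fun n => EFin \o energy_variation (U n) phi) (EFin \o energy_variation u phi) g => //.
- by move=> n; apply/measurable_EFinP; exact: measurable_energy_variation.
- by apply/measurable_EFinP; exact: measurable_energy_variation.
- apply: aeW => z _ /=; apply: cvg_EFin; first exact: nearW.
  apply: cvgMl; apply: cvgMl; apply: continuous_cvg; first exact: odd_powR_continuous.
  have c x : U ^~ x @ \oo --> u x.
    rewrite -[X in _ --> X]addr0; apply: cvgD; first exact: cvg_cst.
    by rewrite -(mul0r (phi x)); apply: cvgMl; exact: cvg_harmonic.
  by apply: cvgB; exact: c.
- apply: aeW => z n _ /=; rewrite lee_fin normrM (ger0_norm (W0 z)).
  rewrite /e !mulrA -mulrDl ler_wpM2r//; apply: le_trans (normr_odd_powRM _ _ p2) _.
  rewrite mulrDl mul1r addrA lerD2r -mulrDr.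
  rewrite (_ : U n z.1 - _ = (u z.1 - u z.2) + n.+1%:R^-1 * (phi z.1 - phi z.2)); last first.
    by rewrite /U; ring.
  have p0 : 0 <= p by have := p2; lra.
  apply: le_trans (normrD_powR _ _ p0) _; rewrite ler_wpM2l ?powR_ge0// lerD2l.
  rewrite ge0_ler_powR ?nnegrE// normrM ler_piMl// ger0_norm ?invr_ge0//.
  by rewrite invf_le1// ler1n.
Qed.

Lemma minimizer_variation_ge u phi : between u ->
  (forall v, between v -> (action u <= action v)%E) ->
  measurable_fun setT phi -> (forall x, ~ Omega x -> phi x = 0) ->
  mu.-integrable Omega (EFin \o phi) -> (energy phi < +oo)%E ->
  ((\int[mu]_(x in Omega) (f (u x) * phi x))%R%:E <=
   \int[mu2]_z (energy_variation u phi z)%:E)%E.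
Proof.
move=> bu umin mphi phi0 iphi Ephi; have [mu_ uM u0] := bu.
have Eu := energy_minimizer_lty bu umin.
have c := energy_variation_cvg mu_ mphi Eu Ephi.
rewrite -(cvg_lim _ c)//; apply: lime_ge; first by apply/cvg_ex; eexists; exact: c.
apply: nearW => n; set t := n.+1%:R^-1.
have t0 : 0 < t by rewrite invr_gt0.
have h1 := minimizer_energy_le bu umin mphi phi0 iphi t0.
have h2 := energy_le_variation t mu_ mphi Eu Ephi.
have mv : measurable_fun setT (fun x => u x + t * phi x).
  by apply: measurable_funD => //; exact: measurable_funM.
have Ev := energyDZ_lty t mu_ mphi Eu Ephi.
have ivar := integrable_energy_variation mv mphi Ev Ephi.
rewrite -[leRHS](@fineK _ (\int[mu2]_z _)%E); last exact: (integrable_fin_num measurableT ivar).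
have cancel (x y : \bar R) (c1 c2 : R) : (0 <= x < +oo)%E ->
    (x + c1%:E <= y)%E -> (y <= x + c2%:E)%E -> c1 <= c2.
  move=> /andP[x0 xy] k1 k2; have := le_trans k1 k2.
  by rewrite leeD2lE ?ge0_fin_numE.
have Eu0 : (0 <= energy u < +oo)%E by apply/andP; split; [exact: energy_ge0|exact: Eu].
have := cancel _ _ _ _ Eu0 h1 h2.
by rewrite lee_fin ler_pM2l ?mulr_gt0//; have := p2; lra.
Qed.

(** The inequality for [phi] and for [- phi]. *)
Lemma minimizer_variation u phi : between u ->
  (forall v, between v -> (action u <= action v)%E) ->
  measurable_fun setT phi -> (forall x, ~ Omega x -> phi x = 0) ->
  mu.-integrable Omega (EFin \o phi) -> (energy phi < +oo)%E ->
  (\int[mu2]_z (energy_variation u phi z)%:E =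
   \int[mu]_(x in Omega) (f (u x) * phi x)%:E)%E.
Proof.
move=> bu umin mphi phi0 iphi Ephi; have [mu_ uM u0] := bu.
have Eu := energy_minimizer_lty bu umin.
have h1 := minimizer_variation_ge bu umin mphi phi0 iphi Ephi.
have mN : measurable_fun setT (fun x => - phi x) by exact: measurable_funN.
have N0 x : ~ Omega x -> - phi x = 0 by move=> /phi0 ->; rewrite oppr0.
have iN : mu.-integrable Omega (EFin \o (fun x => - phi x)).
  by have := integrableN iphi; apply: eq_integrable.
have EN : (energy (fun x => - phi x)%R < +oo)%E.
  have e : energy (fun x => - phi x)%R = energy phi.
    by apply: eq_integral => z _; rewrite -opprD normrN.
  by rewrite e.
have h2 := minimizer_variation_ge bu umin mN N0 iN EN.
have ifphi := integrable_reaction bu mphi iphi.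
have ivar := integrable_energy_variation mu_ mphi Eu Ephi.
have E : (\int[mu]_(x in Omega) (f (u x) * phi x)%:E)%E =
    (\int[mu]_(x in Omega) (f (u x) * phi x))%:E.
  by apply/esym/fineK; exact: (integrable_fin_num mOmega ifphi).
have EvN : (\int[mu2]_z (energy_variation u (fun x => - phi x)%R z)%:E =
    - \int[mu2]_z (energy_variation u phi z)%:E)%E.
  rewrite -integralN; last exact: integrable_add_def ivar.
  apply: eq_integral => z _; rewrite /energy_variation -EFinN; congr EFin.
  by move: (odd_powR p _) => o; ring.
have ErN : \int[mu]_(x in Omega) (f (u x) * - phi x) =
    - \int[mu]_(x in Omega) (f (u x) * phi x).
  by rewrite -mulN1r -(RintegralZl _ mOmega ifphi); apply: eq_Rintegral => x _; ring.
rewrite E; rewrite EvN ErN EFinN leeN2 in h2.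
by apply/eqP; rewrite eq_le; apply/andP; split; [exact: h2|exact: h1].
Qed.

Lemma energyZ c v : measurable_fun setT v -> 0 <= c ->
  energy (fun x => c * v x)%R = ((c `^ p)%:E * energy v)%E.
Proof.
move=> mv c0; rewrite /kernel_energy -ge0_integralZl_EFin ?powR_ge0//.
- apply: eq_integral => z _; rewrite -mulrBr normrM (ger0_norm c0) powRM//.
  by rewrite -EFinM mulrA.
- by move=> z _; rewrite lee_fin mulr_ge0 ?powR_ge0.
- by apply/measurable_EFinP; exact: measurable_energy.
Qed.

(** Along the ray [eps * v] the potential term drops at least like [eps ^ r], while
    the energy grows like [eps ^ p] with [p > r]. *)
Lemma minimizer_neq0 u v (c r : R) : 0 < c -> 0 < r -> r < p -> 0 < M ->
  (forall t, 0 <= t <= M -> F 0 + c * t `^ r <= F t) ->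
  between u -> (forall v, between v -> (action u <= action v)%E) ->
  measurable_fun setT v -> (forall x, 0 <= v x <= 1) ->
  (forall x, ~ Omega x -> v x = 0) -> (energy v < +oo)%E ->
  0 < \int[mu]_(x in Omega) (v x `^ r) ->
  ~ {ae mu, forall x, u x = 0}.
Proof.
move=> c0 r0 rp M_gt0 F_ge bu umin mv v01 v0 Ev I_gt0 u_eq0.
have p0 : 0 < p by have := p2; lra.
have iv : mu.-integrable Omega (EFin \o (fun x => v x `^ r)).
  apply: (@integrable_bounded _ 1).
    by apply: measurable_funTS; apply: (@measurableT_comp _ _ _ _ _ _ (@powR R ^~ r)).
  move=> x _; rewrite ger0_norm ?powR_ge0//; have /andP[vx0 vx1] := v01 x.
  rewrite [leRHS](_ : 1 = 1 `^ r); last by rewrite powR1.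
  by rewrite ge0_ler_powR// ?nnegrE// ltW.
set I := \int[mu]_(x in Omega) (v x `^ r) in I_gt0.
pose E := fine (energy v).
have EE : energy v = E%:E by rewrite fineK// ge0_fin_numE// energy_ge0.
have E0 : 0 <= E by rewrite fine_ge0// energy_ge0.
pose a := \int[mu]_(x in Omega) Phi 0.
have key eps : 0 < eps -> eps <= M -> p * c * I <= eps `^ (p - r) * E.
  move=> e0 eM; pose w x := eps * v x.
  have mw : measurable_fun setT w by exact: measurable_funM.
  have bw : between w.
    split => // [x|x Ox]; last by rewrite /w v0// mulr0.
    have /andP[vx0 vx1] := v01 x; rewrite mulr_ge0 ?(ltW e0)//=.
    by apply: le_trans eM; rewrite ler_piMr// ltW.
  have i0 := integrable_potential (between0 Omega M0).
  have iw := integrable_potential bw.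
  have RE h : mu.-integrable Omega (EFin \o h) ->
      (\int[mu]_(x in Omega) (h x)%:E)%E = (\int[mu]_(x in Omega) h x)%:E.
    by move=> ih; rewrite fineK//; exact: integrable_fin_num.
  have h1 : (a%:E <= action u)%E.
    rewrite /action -(RE _ i0).
    rewrite (ae_eq_integral (fun x => (Phi (u x))%:E)) ?leeDr ?energy_ge0//.
    - exact: measurable_int i0.
    - by apply: measurable_potential => //; exact: bu.
    - by apply: filterS u_eq0 => x ux _; rewrite ux.
  have h2 := le_trans h1 (umin _ bw).
  have h3 : \int[mu]_(x in Omega) Phi (w x) <= a - p * c * eps `^ r * I.
    have iZ : mu.-integrable Omega (EFin \o (fun x => p * c * eps `^ r * v x `^ r)).
      by have := integrableZl mOmega (p * c * eps `^ r) iv; apply: eq_integrable.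
    rewrite /a /I -(RintegralZl _ mOmega iv) -(RintegralB mOmega i0 iZ).
    apply: le_Rintegral => //.
      by have := integrableB mOmega i0 iZ; apply: eq_integrable.
    move=> x _ /=; have wM : 0 <= w x <= M by have [_ ->] := bw.
    have := F_ge _ wM; rewrite /w powRM ?(ltW e0)//; last by have /andP[] := v01 x.
    rewrite /Phi => h; have := ler_wpM2l (ltW p0) h; lra.
  rewrite /action energyZ ?(ltW e0)// EE (RE _ iw) -EFinM -EFinD lee_fin in h2.
  have h4 : p * c * eps `^ r * I <= eps `^ p * E by lra.
  have er : 0 < eps `^ r by rewrite powR_gt0.
  rewrite -(ler_pM2l er) [leRHS]mulrA -powRD; last by rewrite (gt_eqF e0) implybT.
  rewrite (_ : r + (p - r) = p); last by ring.
  by apply: le_trans h4; rewrite le_eqVlt; apply/orP; left; apply/eqP; ring.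
have K0 : 0 < p * c * I by rewrite !mulr_gt0.
(* [key] fails as soon as [eps ^ (p - r) * E < p * c * I]. *)
pose k := p * c * I / (2 * (E + 1)).
have k0 : 0 < k by rewrite divr_gt0// mulr_gt0// ltr_wpDl.
pose eps := Num.min M (k `^ (p - r)^-1).
have pr0 : 0 < p - r by rewrite subr_gt0.
have eps0 : 0 < eps by rewrite lt_min M_gt0 powR_gt0.
have epsM : eps <= M by rewrite ge_min lexx.
have epsk : eps `^ (p - r) <= k.
  rewrite (_ : k = (k `^ (p - r)^-1) `^ (p - r)); last first.
    by rewrite -powRrM mulVf ?gt_eqF// powRr1// ltW.
  by apply: ge0_ler_powR; rewrite ?nnegrE ?powR_ge0 ?(ltW pr0) ?(ltW eps0)// ge_min lexx orbT.
have := key _ eps0 epsM; apply/negP; rewrite -ltNge.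
apply: (@le_lt_trans _ _ (k * E)); first by rewrite ler_wpM2r.
apply: (@le_lt_trans _ _ (p * c * I / 2)); last by rewrite ltr_pdivrMr// ltr_pMr// ltr1n.
rewrite /k invfM mulrA -[leLHS]mulrA ler_piMr//; first by rewrite divr_ge0// ltW.
by rewrite mulrC ler_pdivrMr ?mul1r ?ltr_wpDl// lerDl.
Qed.

(** The domain and the kernel enter through a set [B] that [Omega] sees with a weight
    at least [kap], and through one function [v] of finite energy. *)
Theorem bounded_weak_solution v (c r : R) : 0 < c -> 0 < r -> r < p -> 0 < M ->
  (forall t, 0 <= t <= M -> F 0 + c * t `^ r <= F t) ->
  measurable_fun setT v -> (forall x, 0 <= v x <= 1) ->
  (forall x, ~ Omega x -> v x = 0) -> (energy v < +oo)%E ->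
  0 < \int[mu]_(x in Omega) (v x `^ r) ->
  exists u, [/\ between u, (energy u < +oo)%E, ~ {ae mu, forall x, u x = 0} &
    forall phi, measurable_fun setT phi -> (forall x, ~ Omega x -> phi x = 0) ->
      mu.-integrable Omega (EFin \o phi) -> (energy phi < +oo)%E ->
      (\int[mu2]_z (energy_variation u phi z)%:E =
       \int[mu]_(x in Omega) (f (u x) * phi x)%:E)%E].
Proof.
move=> c0 r0 rp M_gt0 F_ge mv v01 v0 Ev I0.
have [u bu umin] := @action_minimizer _ _ _ mu _ Omega _ mW W0 mOmega p2 _ _
  Phi_cont M0 Phi0 action_zero_lty.
exists u; split; first exact: bu.
- exact: (energy_minimizer_lty bu umin).
- exact: (minimizer_neq0 c0 r0 rp M_gt0 F_ge bu umin mv v01 v0 Ev I0).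
by move=> phi mphi phi0 iphi Ephi; exact: (minimizer_variation bu umin).
Qed.

End euler_lagrange.

(** * Lebesgue measure on row vectors *)

Section row_vectors.
Context {R : realType}.

Lemma coord_le_norm n (x : 'rV[R]_n) i : `|x 0 i| <= `|x|.
Proof.
by rewrite [leRHS]mx_normrE; apply: (@le_bigmax _ _ _ 0 (fun ij => `|x ij.1 ij.2|) (0, i)).
Qed.

Lemma norm_le_coord n (x : 'rV[R]_n) c : 0 <= c -> (forall i, `|x 0 i| <= c) ->
  `|x| <= c.
Proof.
move=> c0 xc; rewrite [leLHS]mx_normrE; apply: bigmax_le => // -[i j] _ /=.
by rewrite (ord1 i).
Qed.

Lemma measurable_sublevel d (T : measurableType d) (f : T -> R) (t : R) :
  measurable_fun setT f -> measurable [set x | f x <= t].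
Proof.
move=> mf; rewrite (_ : [set _ | _] = f @^-1` `]-oo, t]); last first.
  by apply/seteqP; split => x /=; rewrite in_itv.
by rewrite -[X in measurable X]setTI; apply: mf => //; exact: measurable_itv.
Qed.

Lemma closed_norm_ball_compact n (r : R) : compact [set x : 'rV[R]_n | `|x| <= r].
Proof.
apply: bounded_closed_compact.
  by exists r; split; [exact: num_real|move=> M rM x /= /le_trans; apply; exact: ltW].
by apply: (closed_comp _ (@closed_le _ r)) => x _; exact: norm_continuous.
Qed.

Lemma open_measurable_rV n (A : set 'rV[R]_n) : open A -> measurable A.
Proof. by move=> oA; exact: sub_sigma_algebra. Qed.

Lemma continuous_measurable_rV n (h : 'rV[R]_n -> R) : continuous h ->
  measurable_fun setT h.
Proof.
move=> ch; apply: (measurability _ (RGenOpens.measurableE R)) => _ [_ [a [b ->]] <-].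
by rewrite setTI; apply: open_measurable_rV; apply: open_comp => // x _; exact: ch.
Qed.

Lemma rV_cvg n (T : Type) (F : set_system T) (FF : Filter F) (f : T -> 'rV[R]_n)
    (l : 'rV[R]_n) :
  (forall i, f t 0 i @[t --> F] --> l 0 i) -> f @ F --> l.
Proof.
move=> fl; apply/cvgrPdist_le => e e0.
have : \forall t \near F, forall i, `|l 0 i - f t 0 i| <= e.
  by apply: filter_forall => i; have /cvgrPdist_le := fl i; exact.
apply: filterS => t h; apply: norm_le_coord => [|i]; first exact: ltW.
by rewrite !mxE.
Qed.

(** The Borel sets of a product of two finite-dimensional spaces are those of
    the product sigma-algebra: a pair is a row vector of length [n + m]. *)
Lemma continuous_measurable_rVM n m (g : 'rV[R]_n * 'rV[R]_m -> R) : continuous g ->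
  measurable_fun setT g.
Proof.
move=> cg.
pose J (z : 'rV[R]_n * 'rV[R]_m) : 'rV[R]_(n + m) := row_mx z.1 z.2.
pose K (x : 'rV[R]_(n + m)) : 'rV[R]_n * 'rV[R]_m := (lsubmx x, rsubmx x).
have -> : g = (g \o K) \o J.
  by apply/funext => -[x y]; rewrite /= /K /J /= row_mxKl row_mxKr.
apply: measurableT_comp.
  apply: continuous_measurable_rV => x; apply: continuous_comp; last exact: cg.
  have c1 : (lsubmx x0 : 'rV[R]_n) @[x0 --> x] --> (lsubmx x : 'rV[R]_n).
    apply: (@rV_cvg _ _ (nbhs x) (nbhs_filter x)) => i; rewrite mxE.
    under eq_fun do rewrite mxE.
    exact: coord_continuous.
  have c2 : (rsubmx x0 : 'rV[R]_m) @[x0 --> x] --> (rsubmx x : 'rV[R]_m).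
    apply: (@rV_cvg _ _ (nbhs x) (nbhs_filter x)) => i; rewrite mxE.
    under eq_fun do rewrite mxE.
    exact: coord_continuous.
  exact: (cvg_pair c1 c2).
apply: measurable_fun_rV => i; case: (splitP i) => j ij.
  rewrite (_ : (fun _ => _) = (fun x : 'rV[R]_n => x 0 j) \o fst).
    by apply: measurableT_comp; [exact: measurable_coord_rV|exact: measurable_fst].
  by apply/funext => z; rewrite (_ : i = lshift m j) ?row_mxEl//; exact: val_inj.
rewrite (_ : (fun _ => _) = (fun x : 'rV[R]_m => x 0 j) \o snd).
  by apply: measurableT_comp; [exact: measurable_coord_rV|exact: measurable_snd].
by apply/funext => z; rewrite (_ : i = rshift n j) ?row_mxEr//; exact: val_inj.
Qed.

Lemma product_measure_ysection d1 d2 (T1 : measurableType d1) (T2 : measurableType d2)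
    (m1 : {sigma_finite_measure set T1 -> \bar R})
    (m2 : {sigma_finite_measure set T2 -> \bar R}) (A : set (T1 * T2)) :
  measurable A -> ((m1 \x m2) A = \int[m2]_y m1 (ysection A y))%E.
Proof.
move=> mA; have := indic_fubini_tonelli m1 m2 mA.
by rewrite indic_fubini_tonelli_FE// indic_fubini_tonelli_GE.
Qed.

(** A Cavalieri bound, by induction on the dimension. Only the slices of [A] in the
    direction [j] with the previous coordinates frozen are constrained, so that
    shearing [A] along functions of the previous coordinates does not affect the
    bound. *)
Lemma lebesgue_rV_slices n (A : set 'rV[R]_n) (w : 'I_n -> R) :
  measurable A -> (forall j, 0 <= w j) ->
  (forall (j : 'I_n) y y', A y -> A y' -> (forall i : 'I_n, (i < j)%N -> y 0 i = y' 0 i) ->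
     `|y 0 j - y' 0 j| <= w j) ->
  (lebesgue_rV R n A <= (\prod_j (2 * w j))%:E)%E.
Proof.
elim: n A w => [|n IH] A w mA w0 hA.
  by rewrite big_ord0 /= diracE lee_fin; case: (0 \in A).
have [[a Aa]|/nonemptyPn ->] := pselect (A !=set0); last first.
  by rewrite measure0 lee_fin prodr_ge0// => i _; rewrite mulr_ge0.
have mcons : measurable_fun setT (@rV_cons R n).
  apply: measurable_fun_rV => i; case: (splitP i) => j ij.
    rewrite (_ : (fun _ => _) = snd); first exact: measurable_snd.
    apply/funext => z; rewrite /rV_cons (_ : i = lshift n j) ?row_mxEl; last exact: val_inj.
    by rewrite (ord1 j) mxE eqxx.
  rewrite (_ : (fun _ => _) = (fun x : 'rV[R]_n => x 0 j) \o fst).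
    apply: measurableT_comp; [exact: measurable_coord_rV|exact: measurable_fst].
  by apply/funext => z; rewrite /rV_cons (_ : i = rshift 1 j) ?row_mxEr//; exact: val_inj.
have e0 : ord0 = lshift n 0 :> 'I_(1 + n) by exact: val_inj.
have cons0 z : @rV_cons R n z 0 ord0 = z.2.
  by rewrite /rV_cons e0 row_mxEl mxE eqxx.
have consS z i : @rV_cons R n z 0 (lift ord0 i) = z.1 0 i.
  by rewrite /rV_cons (_ : lift ord0 i = rshift 1 i) ?row_mxEr//; exact: val_inj.
rewrite /= /pushforward; set B := _ @^-1` A.
have mB : measurable B by rewrite -[B]setTI; exact: mcons.
have slice y : (lebesgue_rV R n (ysection B y) <= (\prod_j (2 * w (lift ord0 j)))%:E)%E.
  apply: IH => [|//|j x x'].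
    exact: measurable_ysection.
  rewrite /ysection /= !inE /B /= => Ax Ax' xx'.
  have := hA (lift ord0 j) _ _ Ax Ax'; rewrite !consS; apply => i.
  by case: (unliftP ord0 i) => [i' ->|->]; rewrite ?cons0// !consS => /xx'.
have slice0 y : w 0 < `|y - a 0 0| -> ysection B y = set0.
  move=> wy; apply/seteqP; split => // x; rewrite /ysection /= inE /B /= => Ax.
  have := hA ord0 _ _ Ax Aa; rewrite cons0 => /(_ (fun i => ltac:(by [])))/le_lt_trans/(_ wy).
  by rewrite ltxx.
set I := `[a 0 0 - w 0, a 0 0 + w 0]%classic.
set P := \prod_j (2 * w (lift ord0 j)).
have P0 : 0 <= P by apply: prodr_ge0 => j _; rewrite mulr_ge0.
rewrite product_measure_ysection// big_ord_recl -/P.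
apply: (@le_trans _ _ (\int[@lebesgue_measure R]_y (P * \1_I y)%:E)%E).
  apply: ge0_le_integral => //.
  - exact: measurable_fun_ysection.
  - by apply/measurable_EFinP; apply: measurable_funM => //; apply: measurable_indic; exact: measurable_itv.
  move=> y _; have [yw|wy] := leP `|y - a 0 0| (w 0).
    rewrite indicE mem_set ?mulr1; first exact: slice.
    by rewrite /I /= in_itv/= -ler_distlC distrC.
  by rewrite slice0// measure0 lee_fin mulr_ge0.
under eq_integral do rewrite EFinM.
rewrite ge0_integralZl_EFin//; last by apply/measurable_EFinP; apply: measurable_indic; exact: measurable_itv.
rewrite integral_indic//; last exact: measurable_itv.
have lI : lebesgue_measure I = (2 * w 0)%:E.
  rewrite /I lebesgue_measure_itv/= lte_fin; case: ltP => h.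
    by rewrite -EFinB; congr EFin; lra.
  by congr EFin; have := w0 0; lra.
rewrite setIT [X in (_ * X)%E](_ : _ = (2 * w 0)%:E); last exact: lI.
by rewrite -EFinM lee_fin mulrC.
Qed.

End row_vectors.

Section series.
Context d (T : measurableType d) (R : realType) (mu : {measure set T -> \bar R}).

(** The function [g] is at most the sum of the [a j] over the sets [E j], which is
    integrated term by term. *)
Lemma integral_geometric_layers (g : T -> R) (E : (set T)^nat) (a : R^nat) (K th : R) :
  measurable_fun setT g -> (forall x, 0 <= g x) -> (forall j, measurable (E j)) ->
  (forall j, 0 <= a j) -> 0 <= th < 1 ->
  (forall x, g x != 0 -> exists2 j, E j x & g x <= a j) ->
  (forall j, (a j)%:E * mu (E j) <= (K * th ^+ j)%:E)%E ->
  (\int[mu]_x (g x)%:E <= (K / (1 - th))%:E)%E.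
Proof.
move=> mg g0 mE a0 /andP[th0 th1] hg hE.
have mf j : measurable_fun setT (fun x => (a j * \1_(E j) x)%:E).
  by apply/measurable_EFinP; exact: measurable_funM.
have f0 j x : (0 <= (a j * \1_(E j) x)%:E)%E by rewrite lee_fin mulr_ge0.
apply: (@le_trans _ _ (\int[mu]_x (\sum_(j <oo) (a j * \1_(E j) x)%:E))%E).
  apply: ge0_le_integral => //.
  - by move=> x _; rewrite lee_fin.
  - by apply/measurable_EFinP.
  - by apply: ge0_emeasurable_sum.
  move=> x _; have [->|gx] := eqVneq (g x) 0; first by apply: nneseries_ge0.
  have [j Ej gj] := hg x gx.
  apply: (@le_trans _ _ (\sum_(0 <= i < j.+1) (a i * \1_(E i) x)%:E)%E); last first.
    by apply: nneseries_lim_ge.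
  rewrite big_nat_recr//= indicE mem_set// mulr1.
  apply: (@le_trans _ _ (a j)%:E); first by rewrite lee_fin.
  by rewrite leeDr//; exact: sume_ge0.
rewrite integral_nneseries//.
apply: (@le_trans _ _ (\sum_(j <oo) (K * th ^+ j)%:E)%E).
  apply: lee_nneseries => // [j _ _|j _]; first by apply: integral_ge0 => x _; exact: f0.
  apply: le_trans (hE j); under eq_integral do rewrite EFinM.
  by rewrite ge0_integralZl_EFin// ?integral_indic ?setIT//; apply/measurable_EFinP.
have := @cvg_geometric_series R K th; rewrite ger0_norm// => /(_ th1) h.
apply: lime_le.
  apply: is_cvg_nneseries => j _ _; apply: le_trans (hE j).
  by rewrite mule_ge0// lee_fin.
apply: nearW => n.
rewrite sumEFin lee_fin.
have K0 : 0 <= K.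
  by have := hE 0%N; rewrite expr0 mulr1 -lee_fin; apply: le_trans; rewrite mule_ge0 ?lee_fin.
have nd : nondecreasing_seq (series (geometric K th)).
  by apply: nondecreasing_series => i _; rewrite /= mulr_ge0// exprn_ge0.
rewrite -(cvg_lim _ h)//.
by apply: (nondecreasing_cvgn_le nd); apply/cvg_ex; eexists; exact: h.
Qed.

End series.

(** * Dilations and left translations *)

Section mean_value.
Context {R : realType}.

Lemma is_derive_line (V : normedModType R) (h : V -> R) (e z : V) (t : R) :
  derivable h (z + t *: e) e ->
  is_derive t 1 (fun t => h (z + t *: e)) ('D_e h (z + t *: e)).
Proof.
move=> dh.
have E : (fun s : R => s^-1 *: (((fun t : R => h (z + t *: e)) \o shift t) (s *: (1 : R))
      - h (z + t *: e))) =
    (fun s => s^-1 *: ((h \o shift (z + t *: e)) (s *: e) - h (z + t *: e))).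
  apply/funext => s /=; congr (_ *: (h _ - _)).
  by rewrite [_ *: 1]mulr1 scalerDl addrCA.
by apply: DeriveDef; rewrite /derivable /derive E.
Qed.

Lemma mean_value_line (V : normedModType R) (h : V -> R) (e z : V) (dl : R) :
  (forall z, derivable h z e) -> exists2 th, 0 <= th <= 1 &
    h (z + dl *: e) - h z = 'D_e h (z + (th * dl) *: e) * dl.
Proof.
move=> dh.
pose g t := h (z + t *: e); have g0 : g 0 = h z by rewrite /g scale0r addr0.
have dg (t : R) : is_derive t 1 g ('D_e h (z + t *: e)) by exact: is_derive_line.
have cg a b : {within `[a, b], continuous g}.
  apply: continuous_subspaceT => t; apply: differentiable_continuous.
  by apply/derivable1_diffP; exact: ex_derive.
rewrite -g0 -/(g dl); have [d0|d0|->] := ltgtP dl 0.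
- have [c] := MVT d0 (fun t _ => dg t) (@cg _ _).
  rewrite in_itv/= => /andP[c1 c2] E; exists (c / dl).
    by rewrite ler_ndivlMr// mul0r ler_ndivrMr// mul1r !ltW.
  by rewrite divfK ?lt_eqF//; lra.
- have [c] := MVT d0 (fun t _ => dg t) (@cg _ _).
  rewrite in_itv/= => /andP[c1 c2] E; exists (c / dl).
    by rewrite ler_pdivlMr// mul0r ler_pdivrMr// mul1r !ltW.
  by rewrite divfK ?gt_eqF// E subr0.
by exists 0; rewrite ?lexx ?ler01// subrr mulr0.
Qed.

(** Telescoping along the path from [y'] to [y] that changes one coordinate at a
    time, with the mean value theorem on each segment. *)
Lemma mean_value_path n (h : 'rV[R]_n -> R) (y y' : 'rV[R]_n) :
  (forall j z, derivable h z (delta_mx 0 j)) ->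
  exists2 xi : 'I_n -> 'rV[R]_n, (forall j, `|xi j| <= Num.max `|y| `|y'|) &
    h y - h y' = \sum_j 'D_(delta_mx 0 j) h (xi j) * (y 0 j - y' 0 j).
Proof.
move=> dh.
pose P (m : nat) : 'rV[R]_n := \row_j (if (j < m)%N then y 0 j else y' 0 j).
have P0 : P 0%N = y' by apply/rowP => j; rewrite mxE.
have Pn : P n = y by apply/rowP => j; rewrite mxE ltn_ord.
have PS (m : 'I_n) : P m.+1 = P m + (y 0 m - y' 0 m) *: delta_mx 0 m.
  apply/rowP => j; rewrite !mxE eqxx /= ltnS.
  have [->|jm] := eqVneq j m; first by rewrite leqnn ltnn mulr1 subrKC.
  by rewrite mulr0 addr0 leq_eqVlt -[(j == m :> nat)]/(j == m) (negbTE jm).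
have /choice[th hth] : forall m : 'I_n, exists th : R, 0 <= th <= 1 /\
    h (P m.+1) - h (P m) = 'D_(delta_mx 0 m) h
      (P m + (th * (y 0 m - y' 0 m)) *: delta_mx 0 m) * (y 0 m - y' 0 m).
  move=> m; rewrite PS.
  by have [th ? ?] := mean_value_line (P m) (y 0 m - y' 0 m) (dh m); exists th.
exists (fun m : 'I_n => P m + (th m * (y 0 m - y' 0 m)) *: delta_mx 0 m).
  move=> m; apply: norm_le_coord => [|j]; first by rewrite le_max normr_ge0.
  have hy := coord_le_norm y j; have hy' := coord_le_norm y' j.
  rewrite !mxE eqxx /=; have [->|jm] := eqVneq j m; last first.
    rewrite mulr0 addr0 le_max; case: ifP => _; first by rewrite hy.
    by rewrite hy' orbT.
  rewrite ltnn mulr1; have [/andP[t0 t1] _] := hth m.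
  rewrite (_ : _ + _ = th m * y 0 m + (1 - th m) * y' 0 m); last by ring.
  set K := Num.max _ _.
  have yK : `|y 0 m| <= K by apply: le_trans (coord_le_norm _ _) _; rewrite le_max lexx.
  have yK' : `|y' 0 m| <= K by apply: le_trans (coord_le_norm _ _) _; rewrite le_max lexx orbT.
  apply: le_trans (ler_normD _ _) _; rewrite !normrM (ger0_norm t0).
  rewrite (ger0_norm (_ : 0 <= 1 - th m)) ?subr_ge0//.
  have := ler_wpM2l t0 yK; have t1' : 0 <= 1 - th m by lra.
  by have := ler_wpM2l t1' yK'; lra.
rewrite -{1}Pn -{1}P0 -(telescope_sumr (h \o P))// big_mkord.
by apply: eq_bigr => m _; have [_ <-] := hth m.
Qed.

End mean_value.

Section homogeneous_group.
Context {R : realType} {n : nat}.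
Local Notation V := 'rV[R]_n.
Variables (wt : 'I_n -> nat) (dil : R -> V -> V).
Hypothesis wt_gt0 : forall j, (0 < wt j)%N.
Hypothesis dilE : forall l x j, dil l x 0 j = l ^+ wt j * x 0 j.

Lemma norm_dil_le l x : 0 <= l <= 1 -> `|dil l x| <= l * `|x|.
Proof.
move=> /andP[l0 l1]; apply: norm_le_coord => [|j]; first by rewrite mulr_ge0.
rewrite dilE normrM; apply: ler_pM => //; last exact: coord_le_norm.
rewrite normrX ger0_norm//.
by rewrite -(prednK (wt_gt0 j)) exprS ler_piMr// exprn_ile1.
Qed.

Section quasi_norm.
Variable N : V -> R.
Hypotheses (N_cont : continuous N) (N_ge0 : forall x, 0 <= N x).
Hypothesis N_eq0 : forall x, N x = 0 <-> x = 0.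
Hypothesis N_dil : forall l x, 0 < l -> N (dil l x) = l * N x.

(** The unit sphere of the maximum norm is compact and meets every orbit of
    the dilations outside the origin. *)
Lemma quasi_norm_coord : exists2 c : R, 0 < c &
  forall (x : V) j, `|x 0 j| <= (N x / c) ^+ wt j.
Proof.
pose S := [set x : V | `|x| = 1].
have [[a Sa]|/nonemptyPn S0] := pselect (S !=set0); last first.
  exists 1 => // x j; suff : S (delta_mx 0 j) by rewrite S0.
  rewrite /S/=; apply/eqP; rewrite eq_le; apply/andP; split.
    apply: norm_le_coord => // i; rewrite mxE eqxx /=.
    by case: (i == j); rewrite ?normr1 ?normr0.
  by apply: le_trans (coord_le_norm _ j); rewrite mxE !eqxx normr1.
have cS : compact S.
  apply: bounded_closed_compact.
    by exists 1; split => // M M1 x /= ->; exact: ltW.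
  have -> : S = (fun x : V => `|x|) @^-1` [set 1] by [].
  apply: closed_comp; last exact: closed_eq.
  by move=> x _; exact: norm_continuous.
have [s Ss sN] := compact_EVT_min (ex_intro _ a Sa) cS (continuous_subspaceT N_cont).
have c0 : 0 < N s.
  rewrite lt_neqAle N_ge0 andbT eq_sym; apply/eqP => /N_eq0 s0.
  by move: Ss; rewrite inE /S/= s0 normr0 => /esym/eqP; rewrite oner_eq0.
exists (N s) => // x j.
have [->|x0] := eqVneq x 0.
  by rewrite mxE normr0 exprn_ge0// divr_ge0// ltW.
pose r i := `|x 0 i| `^ (wt i)%:R^-1.
have rX i : r i ^+ wt i = `|x 0 i|.
  rewrite /r -powR_mulrn ?powR_ge0// -powRrM mulVf ?powRr1//.
  by rewrite pnatr_eq0 -lt0n.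
have r0 i : 0 <= r i by exact: powR_ge0.
have [i ri] : exists i, forall i', r i' <= r i.
  have [i _ hi] := @arg_maxP _ _ 'I_n j xpredT r isT.
  by exists i => i'; exact: hi.
have ri0 : 0 < r i.
  rewrite lt_neqAle r0 andbT eq_sym; apply/eqP => e; move/eqP: x0; apply.
  apply/rowP => i'; rewrite mxE; apply/eqP; rewrite -normr_eq0 -rX.
  have : r i' <= 0 by rewrite -e.
  by move=> h; rewrite expf_eq0 wt_gt0 /= eq_le h r0.
have Sd : S (dil (r i)^-1 x).
  have E i' : `|dil (r i)^-1 x 0 i'| = (r i' / r i) ^+ wt i'.
    by rewrite dilE normrM -rX normrX ger0_norm ?invr_ge0// -exprMn mulrC.
  rewrite /S/=; apply/eqP; rewrite eq_le; apply/andP; split.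
    apply: norm_le_coord => // i'; rewrite E exprn_ile1 ?divr_ge0//.
    by rewrite ler_pdivrMr// mul1r.
  by apply: le_trans (coord_le_norm _ i); rewrite E divff ?gt_eqF// expr1n.
have := sN _ (mem_set Sd); rewrite N_dil ?invr_gt0// => h.
rewrite -rX lerXn2r ?nnegrE ?divr_ge0 ?(ltW c0)//.
apply: le_trans (ri j) _; rewrite ler_pdivlMr//.
by move: h; rewrite mulrC ler_pdivlMr// mulrC.
Qed.

End quasi_norm.

Variable op : V -> V -> V.
Hypothesis op0x : forall y, op 0 y = y.
Hypothesis op_dil : forall l x y, 0 < l -> dil l (op x y) = op (dil l x) (dil l y).
Hypothesis op_C1 : forall z v, derivable (fun z : V * V => op z.1 z.2) z v.
Hypothesis dop_cont : forall v, continuous ('D_v (fun z : V * V => op z.1 z.2)).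

Definition dop i j x : V -> R := 'D_(delta_mx 0 j) (fun y => op x y 0 i).

Let opi i (z : V * V) := op z.1 z.2 0 i.

Let derivable_opi i z v : derivable (opi i) z v.
Proof. by have /derivable_mxP h := @op_C1 z v; exact: (h 0 i). Qed.

Let quotient_opi i j x y :
  (fun h : R => h^-1 *: ((opi i \o shift (x, y)) (h *: (0, delta_mx 0 j)) - opi i (x, y))) =
  (fun h => h^-1 *: (((fun y => op x y 0 i) \o shift y) (h *: delta_mx 0 j) - op x y 0 i)).
Proof. by apply/funext => h; rewrite /opi /= scaler0 add0r. Qed.

Lemma derivable_op i j x y : derivable (fun y => op x y 0 i) y (delta_mx 0 j).
Proof.
by have := @derivable_opi i (x, y) (0, delta_mx 0 j); rewrite /derivable quotient_opi.
Qed.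

Lemma dopE i j x y : dop i j x y = 'D_(0, delta_mx 0 j) (opi i) (x, y).
Proof. by rewrite /dop /derive quotient_opi. Qed.

Lemma dop_continuous i j : continuous (fun z : V * V => dop i j z.1 z.2).
Proof.
move=> z.
have E : (fun z : V * V => dop i j z.1 z.2) =
    (fun x : V => x 0 i) \o 'D_(0, delta_mx 0 j) (fun z : V * V => op z.1 z.2).
  by apply/funext => -[x y]; rewrite dopE /= derive_mx//= mxE.
by rewrite E; apply: continuous_comp; [exact: dop_cont|exact: coord_continuous].
Qed.

Lemma dop_dil i j l x y : 0 < l ->
  l ^+ wt j * dop i j (dil l x) (dil l y) = l ^+ wt i * dop i j x y.
Proof.
move=> l0.
pose g x y (t : R) := op x (y + t *: delta_mx 0 j) 0 i.
have dg x' y' : is_derive (0 : R) 1 (g x' y') (dop i j x' y').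
  have := @is_derive_line R V (fun y => op x' y 0 i) (delta_mx 0 j) y' 0.
  by rewrite scale0r addr0 => /(_ (@derivable_op _ _ _ _)).
have E : (fun t => l ^+ wt i * g x y t) = g (dil l x) (dil l y) \o (fun t => l ^+ wt j * t).
  apply/funext => t; rewrite /g/= -dilE op_dil//; congr (op _ _ 0 i).
  apply/rowP => i'; rewrite !(dilE, mxE) mulrDr; congr (_ + _).
  by case: (i' =P j) => [->|_]; rewrite ?mulr0// mulrA.
have d1 : is_derive (0 : R) 1 (fun t => l ^+ wt i * g x y t) (l ^+ wt i * dop i j x y).
  exact: is_deriveZ.
have d2 : is_derive (0 : R) 1 (g (dil l x) (dil l y) \o (fun t => l ^+ wt j * t))
    (dop i j (dil l x) (dil l y) * l ^+ wt j).
  apply: is_derive1_comp; first by rewrite mulr0; exact: dg.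
  rewrite -[X in is_derive _ _ _ X]mulr1.
  exact: (is_deriveZ _ (is_derive_id _ _)).
rewrite mulrC -(@derive_val _ _ _ _ _ _ _ d2) -E.
exact: (@derive_val _ _ _ _ _ _ _ d1).
Qed.

(** The derivative is homogeneous of degree [wt i - wt j] under dilations and
    continuous at the origin: it vanishes if the degree is negative, and it is
    constant if the degree is zero. At the origin [op 0 y = y] gives its value. *)
Lemma dop_triangular i j x y : (wt i <= wt j)%N -> dop i j x y = (i == j)%:R.
Proof.
move=> ij; pose l (m : nat) : R := m.+1%:R^-1.
have l0 m : 0 < l m by rewrite invr_gt0.
have l1 m : 0 <= l m <= 1 by rewrite ltW//= invf_le1// ler1n.
have cl : l @ \oo --> (0 : R) by exact: cvg_harmonic.
have cdil z : dil (l m) z @[m --> \oo] --> (0 : V).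
  apply/cvgr0Pnorm_le => e e0.
  have cz : l m * `|z| @[m --> \oo] --> (0 : R).
    by rewrite -(mul0r `|z|); apply: cvgMl.
  move/cvgr0Pnorm_le : cz => /(_ e e0); apply: filterS => m h.
  apply: le_trans (norm_dil_le _ (l1 m)) _.
  by apply: le_trans h; exact: ler_norm.
have d00 : dop i j 0 0 = (i == j)%:R.
  have -> : dop i j 0 0 = 'D_(delta_mx 0 j) (fun y : V => y 0 i) 0.
    rewrite /dop (_ : (fun y' => op 0 y' 0 i) = (fun y' : V => y' 0 i))//.
    by apply/funext => y'; rewrite op0x.
  have E : (fun h : R => h^-1 *: (((fun y : V => y 0 i) \o shift 0) (h *: delta_mx 0 j) - (0 : V) 0 i))
      @ 0^' --> ((i == j)%:R : R).
    apply: cvg_near_cst; near=> h; have h0 : h != 0 by near: h; exact: nbhs_dnbhs_neq.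
    by rewrite /= !mxE subr0 addr0 eqxx /= /GRing.scale/= mulrA mulVf// mul1r.
  exact: cvg_lim E.
have scaling m : dop i j x y = l m ^+ (wt j - wt i) * dop i j (dil (l m) x) (dil (l m) y).
  have := dop_dil i j x y (l0 m); rewrite -{1}(subnK ij) exprD [_ * l m ^+ wt i]mulrC -mulrA.
  by move/(mulfI (lt0r_neq0 (exprn_gt0 _ (l0 m)))).
have cdop : dop i j (dil (l m) x) (dil (l m) y) @[m --> \oo] --> dop i j 0 0.
  exact: (cvg_comp _ _ (cvg_pair (cdil x) (cdil y)) (@dop_continuous i j (0, 0))).
have cX : l m ^+ (wt j - wt i) @[m --> \oo] --> ((0 : R) ^+ (wt j - wt i)).
  by apply: (@continuous_cvg _ _ _ _ _ _ (fun t : R => t ^+ (wt j - wt i))) => //; exact: exprn_continuous.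
have clim : l m ^+ (wt j - wt i) * dop i j (dil (l m) x) (dil (l m) y) @[m --> \oo] -->
    ((0 : R) ^+ (wt j - wt i) * dop i j 0 0) by exact: cvgM.
have ccst : l m ^+ (wt j - wt i) * dop i j (dil (l m) x) (dil (l m) y) @[m --> \oo] -->
    dop i j x y.
  by apply: cvg_near_cst; apply: nearW => m; rewrite -scaling.
rewrite (cvg_unique (@Rhausdorff R) ccst clim) d00; have [->|ne] := eqVneq i j.
  by rewrite subnn expr0 mul1r.
by rewrite mulr0.
Unshelve. all: by end_near. Qed.

(** In the mean value formula the directions of smaller weight do not contribute,
    since [y] and [y'] agree there, and the derivatives in the other directions
    are known. Left translations are therefore shears. *)
Lemma op_triangular (x y y' : V) i : (forall j, (wt j < wt i)%N -> y 0 j = y' 0 j) ->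
  op x y 0 i - op x y' 0 i = y 0 i - y' 0 i.
Proof.
move=> yy'.
have [xi _ ->] := mean_value_path y y' (fun j z => @derivable_op i j x z).
rewrite (bigD1 i)//= -/(dop i i x _) dop_triangular// eqxx mul1r.
rewrite big1 ?addr0// => j ji; have [ij|ij] := leqP (wt i) (wt j).
  by rewrite -/(dop i j x _) dop_triangular// eq_sym (negbTE ji) mul0r.
by rewrite yy'// subrr mulr0.
Qed.

Hypothesis opx0 : forall x, op x 0 = x.

Lemma op_lipschitz (R1 R2 : R) : exists2 L : R, 0 <= L &
  forall x w : V, `|x| <= R1 -> `|w| <= R2 -> `|op x w - x| <= L * `|w|.
Proof.
have /choice[C hC] : forall ij : 'I_n * 'I_n, exists C : R, forall x w,
    `|x| <= R1 -> `|w| <= R2 -> `|dop ij.1 ij.2 x w| <= C.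
  move=> [i j].
  have cc := compact_setX (@closed_norm_ball_compact R n R1) (@closed_norm_ball_compact R n R2).
  have := continuous_compact (continuous_subspaceT (@dop_continuous i j)) cc.
  move=> /compact_bounded[M [_ hM]]; exists (M + 1) => x w xR wR.
  by apply: (hM (M + 1)); [lra|exists (x, w)].
pose L := \sum_i \sum_j `|C (i, j)|; exists L.
  by apply: sumr_ge0 => i _; exact: sumr_ge0.
move=> x w xR wR; apply: norm_le_coord => [|i].
  by rewrite mulr_ge0//; apply: sumr_ge0 => i _; exact: sumr_ge0.
rewrite !mxE -{2}(opx0 x).
have [xi xiw ->] := mean_value_path w 0 (fun j z => @derivable_op i j x z).
apply: (@le_trans _ _ ((\sum_j `|C (i, j)|) * `|w|)); last first.
  rewrite ler_wpM2r// /L [leRHS](bigD1 i)//= lerDl.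
  by apply: sumr_ge0 => i' _; exact: sumr_ge0.
rewrite mulr_suml; apply: le_trans (ler_norm_sum _ _ _) _; apply: ler_sum => j _.
rewrite mxE subr0 normrM ler_pM//; last exact: coord_le_norm.
apply: le_trans (ler_norm (C (i, j))); apply: (hC (i, j)) => //.
by apply: le_trans (xiw j) _; rewrite normr0 max_l.
Qed.

End homogeneous_group.

(** * Functions of finite energy *)

Lemma dyadic_scale (R : realType) (t : R) : 0 < t <= 1 ->
  exists j, 2^-1 ^+ j.+1 < t <= 2^-1 ^+ j.
Proof.
move=> /andP[t0 t1].
have ex : exists j, 2^-1 ^+ j.+1 < t.
  have : 2^-1 ^+ j @[j --> \oo] --> (0 : R) by apply: cvg_expr; rewrite ger0_norm; lra.
  move=> /cvgrPdist_lt/(_ _ t0)[j _ /(_ j.+1 (leqnSn j))]; rewrite sub0r normrN.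
  by rewrite ger0_norm ?exprn_ge0// => h; exists j.
exists (ex_minn ex); case: ex_minnP => -[|j] -> hj /=; first by rewrite expr0.
by rewrite leNgt; apply/negP => /hj; rewrite ltnn.
Qed.

Section dyadic.
Context d (T : measurableType d) (R : realType) (mu : {measure set T -> \bar R}).
Variables (rho g : T -> R) (Q : nat) (C A a : R).
Hypotheses (mrho : measurable_fun setT rho) (mg : measurable_fun setT g).
Hypotheses (g0 : forall x, 0 <= g x) (C0 : 0 <= C) (A0 : 0 <= A) (a0 : 0 < a).
Hypothesis volume : forall t : R, 0 <= t ->
  (mu [set x | (rho x <= t)%R] <= (C * t ^+ Q)%:E)%E.

Let th : R := 2^-1 `^ a.

Let th01 : 0 <= th < 1.
Proof.
rewrite powR_ge0 /= [ltRHS](_ : 1 = 1 `^ a); last by rewrite powR1.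
by rewrite gt0_ltr_powR// ?nnegrE//; lra.
Qed.

Let mlevel t : measurable [set x | rho x <= t].
Proof. exact: measurable_sublevel. Qed.

Let th_expr j : (2^-1 ^+ j) `^ a = th ^+ j.
Proof.
have h2 : (0 : R) <= 2^-1 by lra.
rewrite /th; move: (2^-1) h2 => x x0.
by rewrite -(powR_mulrn j x0) -(powR_mulrn j (powR_ge0 x a)) powRAC.
Qed.

(** On the shell [2 ^- j.+1 < rho <= 2 ^- j] the volume bound [C * 2 ^- (j * Q)]
    cancels [rho ^- Q] up to [2 ^ Q], and [rho ^ a] leaves a geometric series. *)
Lemma integral_dyadic_near :
  (forall x, g x != 0 -> 0 < rho x <= 1 /\ g x <= A * rho x `^ a / rho x ^+ Q) ->
  (\int[mu]_x (g x)%:E <= (A * 2 ^+ Q * C / (1 - th))%:E)%E.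
Proof.
move=> hg; pose h j : R := 2^-1 ^+ j.
have h0 j : 0 < h j by rewrite exprn_gt0//; lra.
apply: (@integral_geometric_layers _ _ _ mu g (fun j => [set x | rho x <= h j])
   (fun j => A * h j `^ a * (2 ^+ Q / h j ^+ Q))) => //.
- by move=> j; rewrite !mulr_ge0 ?powR_ge0 ?invr_ge0 ?exprn_ge0// ltW.
- move=> x /hg[r01 gx]; have [j /andP[rj1 rj2]] := dyadic_scale r01.
  exists j => //; apply: le_trans gx _; have /andP[r0 _] := r01.
  rewrite -!mulrA ler_wpM2l//; apply: ler_pM; rewrite ?powR_ge0 ?invr_ge0 ?exprn_ge0 ?(ltW r0)//.
    by rewrite ge0_ler_powR// ?nnegrE// ltW.
  have -> : 2 ^+ Q / h j ^+ Q = ((h j / 2) ^+ Q)^-1 by rewrite expr_div_n invf_div.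
  have h20 : 0 < h j / 2 by rewrite divr_gt0.
  rewrite lef_pV2 ?posrE ?exprn_gt0// lerXn2r// ?nnegrE ?(ltW r0) ?(ltW h20)//.
  by move: rj1; rewrite exprS mulrC -/(h j) => /ltW.
- move=> j; apply: le_trans (lee_wpmul2l _ (volume (ltW (h0 j)))) _.
    by rewrite lee_fin !mulr_ge0 ?powR_ge0 ?invr_ge0 ?exprn_ge0// ltW.
  rewrite -EFinM lee_fin th_expr; set X := h j ^+ Q.
  have X0 : X != 0 by rewrite gt_eqF// exprn_gt0.
  by rewrite le_eqVlt; apply/orP; left; apply/eqP; field.
Qed.

(** The same with the shells [2 ^ j < rho <= 2 ^ j.+1]. *)
Lemma integral_dyadic_far :
  (forall x, g x != 0 -> 1 < rho x /\ g x <= A * rho x `^ (- a) / rho x ^+ Q) ->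
  (\int[mu]_x (g x)%:E <= (A * 2 ^+ Q * C / (1 - th))%:E)%E.
Proof.
move=> hg; pose h j : R := 2^-1 ^+ j.
have h0 j : 0 < h j by rewrite exprn_gt0//; lra.
apply: (@integral_geometric_layers _ _ _ mu g (fun j => [set x | rho x <= 2 / h j])
   (fun j => A * h j `^ a * h j ^+ Q)) => //.
- by move=> j; rewrite !mulr_ge0 ?powR_ge0 ?exprn_ge0// ltW.
- move=> x /hg[r1 gx]; have r0 : 0 < rho x by lra.
  have [|j /andP[rj1 rj2]] := @dyadic_scale R (rho x)^-1.
    by rewrite invr_gt0 r0 invf_le1// ltW.
  exists j => /=.
    move: rj1; rewrite exprS -/(h j) -(ltr_pM2l r0) mulfV ?gt_eqF// => hj.
    by rewrite ler_pdivlMr//; lra.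
  apply: le_trans gx _.
  rewrite -!mulrA ler_wpM2l//; apply: ler_pM; rewrite ?powR_ge0 ?invr_ge0 ?exprn_ge0 ?(ltW r0)//.
    rewrite powRN -powR_inv1 ?powR_ge0// powRAC powR_inv1 ?(ltW r0)//.
    by rewrite ge0_ler_powR// ?nnegrE ?invr_ge0 ltW.
  by rewrite -exprVn lerXn2r// ?nnegrE ?invr_ge0 ltW.
- move=> j; have h2 : 0 <= 2 / h j by rewrite divr_ge0// ltW.
  apply: le_trans (lee_wpmul2l _ (volume h2)) _.
    by rewrite lee_fin !mulr_ge0 ?powR_ge0 ?exprn_ge0// ltW.
  rewrite -EFinM lee_fin th_expr expr_div_n; set X := h j ^+ Q.
  have X0 : X != 0 by rewrite gt_eqF// exprn_gt0.
  by rewrite le_eqVlt; apply/orP; left; apply/eqP; field.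
Qed.

End dyadic.

Section tent.
Context {R : realType} {n : nat}.
Local Notation V := 'rV[R]_n.
Local Notation mu := (lebesgue_rV R n).
Variables (wt : 'I_n -> nat) (dil : R -> V -> V) (N : V -> R).
Variables (op : V -> V -> V) (inv : V -> V).
Hypothesis wt_gt0 : forall j, (0 < wt j)%N.
Hypothesis wt_mono : forall i j : 'I_n, (wt i < wt j)%N -> (i < j)%N.
Hypothesis dilE : forall l x j, dil l x 0 j = l ^+ wt j * x 0 j.
Hypotheses (N_cont : continuous N) (N_ge0 : forall x, 0 <= N x).
Hypothesis N_eq0 : forall x, N x = 0 <-> x = 0.
Hypothesis N_dil : forall l x, 0 < l -> N (dil l x) = l * N x.
Hypothesis N_inv : forall x, N (inv x) = N x.
Hypotheses (opA : associative op) (op0x : left_id 0 op) (opx0 : right_id 0 op).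
Hypotheses (opVx : left_inverse 0 inv op) (opxV : right_inverse 0 inv op).
Hypothesis op_dil : forall l x y, 0 < l -> dil l (op x y) = op (dil l x) (dil l y).
Hypothesis op_cont : continuous (fun z : V * V => op z.1 z.2).
Hypothesis inv_cont : continuous inv.
Hypothesis op_C1 : forall z v, derivable (fun z : V * V => op z.1 z.2) z v.
Hypothesis dop_cont : forall v, continuous ('D_v (fun z : V * V => op z.1 z.2)).

Definition quasi_dist (z : V * V) : R := N (op (inv z.1) z.2).

Lemma quasi_dist_continuous : continuous quasi_dist.
Proof.
move=> z; apply: (@continuous_comp _ _ _ (fun z : V * V => op (inv z.1) z.2) N);
  last exact: N_cont.
have c1 : inv z'.1 @[z' --> z] --> inv z.1.
  by apply: (@continuous_comp _ _ _ fst inv); [exact: cvg_fst|exact: inv_cont].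
have c2 : z'.2 @[z' --> z] --> z.2 by exact: cvg_snd.
apply: (@continuous_comp _ _ _ (fun z : V * V => (inv z.1, z.2)) (fun z : V * V => op z.1 z.2));
  last exact: op_cont.
exact: (cvg_pair c1 c2).
Qed.

Lemma quasi_distC x y : quasi_dist (x, y) = quasi_dist (y, x).
Proof.
rewrite /quasi_dist /= -N_inv; congr N.
have inv_uniq u v : op u v = 0 -> inv v = u.
  by move=> uv; rewrite -[LHS]op0x -uv -opA opxV opx0.
by apply: inv_uniq; rewrite opA -(opA _ x) opxV opx0 opVx.
Qed.

Lemma measurable_quasi_dist x : measurable_fun setT (fun y => quasi_dist (x, y)).
Proof.
have h : continuous (fun y : V => quasi_dist (x, y)).
  move=> y; apply: (@continuous_comp _ _ _ (fun y : V => (x, y)) quasi_dist).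
    have c1 : cst x y' @[y' --> y] --> x := @cvg_cst _ x _ (nbhs y) (nbhs_filter y).
    have c2 : y' @[y' --> y] --> y by exact: cvg_id.
    exact: (cvg_pair c1 c2).
  exact: quasi_dist_continuous.
exact: continuous_measurable_rV.
Qed.

Local Notation Q := (\sum_j wt j)%N.

(** In a quasi-ball of radius [t] the coordinates of weight [w] are [O(t ^ w)] by
    homogeneity. The left translation by [x] shears the coordinates along those of
    smaller weight, which come first, and [lebesgue_rV_slices] is insensitive to
    this. *)
Lemma quasi_ball_volume : exists2 C : R, 0 <= C & forall x (t : R), 0 <= t ->
  (mu [set y | (quasi_dist (x, y) <= t)%R] <= (C * t ^+ Q)%:E)%E.
Proof.
have [c c0 hc] := quasi_norm_coord wt_gt0 dilE N_cont N_ge0 N_eq0 N_dil.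
exists (\prod_j (2 * (2 * c ^- wt j))).
  by apply: prodr_ge0 => j _; rewrite !mulr_ge0// invr_ge0 exprn_ge0// ltW.
move=> x t t0; set A := [set y | _].
have mA : measurable A by exact: (measurable_sublevel t (measurable_quasi_dist x)).
have tc0 : 0 <= t / c by rewrite divr_ge0// ltW.
pose w j : R := 2 * (t / c) ^+ wt j.
have w0 j : 0 <= w j by rewrite mulr_ge0// exprn_ge0.
have slices (j : 'I_n) (y y' : V) : A y -> A y' ->
    (forall i : 'I_n, (i < j)%N -> y 0 i = y' 0 i) -> `|y 0 j - y' 0 j| <= w j.
  rewrite /A /quasi_dist /= => Ay Ay' yy'.
  have tri := @op_triangular R n wt dil wt_gt0 dilE op op0x op_dil op_C1 dop_cont.
  rewrite -(tri (inv x) y y'); last by move=> i ij; apply: yy'; exact: wt_mono.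
  have bnd u : N u <= t -> `|u 0 j| <= (t / c) ^+ wt j.
    move=> Nu; apply: le_trans (hc u j) _; rewrite lerXn2r ?nnegrE ?divr_ge0 ?(ltW c0)//.
    by rewrite ler_wpM2r// invr_ge0 ltW.
  apply: le_trans (ler_normB _ _) _; rewrite /w mulr_natl mulr2n.
  by apply: lerD; exact: bnd.
apply: le_trans (lebesgue_rV_slices mA w0 slices) _.
rewrite lee_fin le_eqVlt; apply/orP; left; apply/eqP.
rewrite -prodrXr -big_split/=; apply: eq_bigr => j _.
by rewrite /w expr_div_n -!mulrA [c ^- _ * _]mulrC.
Qed.

(** All weights are at least [1], so that a point of quasi-norm at most [1] has a
    norm of at most the order of its quasi-norm. *)
Lemma translation_lipschitz (R1 : R) : exists2 L : R, 0 <= L & forall x y,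
  `|x| <= R1 -> quasi_dist (x, y) <= 1 -> `|y - x| <= L * quasi_dist (x, y).
Proof.
have [c c0 hc] := quasi_norm_coord wt_gt0 dilE N_cont N_ge0 N_eq0 N_dil.
pose c' : R := \sum_j c ^- wt j.
have c'0 : 0 <= c' by apply: sumr_ge0 => j _; rewrite invr_ge0 exprn_ge0// ltW.
have [L L0 hL] := @op_lipschitz R n op op_C1 dop_cont opx0 R1 c'.
exists (L * c') => [|x y xR]; first exact: mulr_ge0.
set w := op (inv x) y; rewrite /quasi_dist /= -/w => w1.
have -> : y = op x w by rewrite /w opA opxV op0x.
have wN : `|w| <= c' * N w.
  apply: norm_le_coord => [|j]; first exact: mulr_ge0.
  apply: le_trans (hc w j) _; rewrite expr_div_n mulrC.
  apply: ler_pM; rewrite ?invr_ge0 ?exprn_ge0 ?(ltW c0)//.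
    rewrite /c' (bigD1 j)//= lerDl; apply: sumr_ge0 => i _.
    by rewrite invr_ge0 exprn_ge0// ltW.
  by rewrite -(prednK (wt_gt0 j)) exprS ler_piMr// exprn_ile1.
rewrite -mulrA; apply: le_trans (hL x w xR _) _; last by rewrite ler_wpM2l.
by apply: le_trans wN _; rewrite ler_piMr.
Qed.

Variables (s p : R) (s0 : 0 < s) (s1 : s < 1) (p2 : 2 <= p).

Definition quasi_kernel (z : V * V) : R := (quasi_dist z `^ (Q%:R + p * s))^-1.

Lemma quasi_kernel_ge0 z : 0 <= quasi_kernel z.
Proof. by rewrite invr_ge0 powR_ge0. Qed.

Lemma measurable_quasi_kernel : measurable_fun setT quasi_kernel.
Proof.
rewrite (_ : quasi_kernel = (@powR R ^~ (- (Q%:R + p * s))) \o quasi_dist); last first.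
  by apply/funext => z; rewrite /quasi_kernel /= powRN.
apply: measurableT_comp; first exact: measurable_powR.
by apply: continuous_measurable_rVM; exact: quasi_dist_continuous.
Qed.

Variables (x0 : V) (r : R) (r0 : 0 < r).

(** A Lipschitz function supported in a ball: it witnesses that the space of
    functions of finite energy is not trivial. *)
Definition tent (x : V) : R := Num.max (1 - `|x - x0| / r) 0.

Lemma measurable_tent : measurable_fun setT tent.
Proof.
have cN : continuous (fun x : V => `|x - x0|).
  move=> x; apply: (@continuous_comp _ _ _ (fun x => x - x0) (fun x => `|x|)).
    exact: (@cvgB _ _ _ (nbhs x) (nbhs_filter x) id (cst x0) x x0 cvg_id (@cvg_cst _ x0 _ _ (nbhs_filter x))).
  exact: norm_continuous.
have c : continuous (fun x : V => 1 - `|x - x0| / r).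
  move=> x; have c1 : `|y - x0| / r @[y --> nbhs x] --> `|x - x0| / r.
    by apply: (@cvgMl _ _ (nbhs x) (nbhs_filter x)); exact: cN.
  apply: (@cvgB _ _ _ (nbhs x) (nbhs_filter x)); last exact: c1.
  exact: (@cvg_cst _ _ _ (nbhs x) (nbhs_filter x)).
apply: (@measurable_maxr _ _ _ _ (fun x : V => 1 - `|x - x0| / r) (cst 0)) => //.
exact: continuous_measurable_rV.
Qed.

Lemma tent01 x : 0 <= tent x <= 1.
Proof.
rewrite /tent le_max lexx orbT ge_max ler01 andbT /=.
by rewrite gerBl divr_ge0// ltW.
Qed.

Lemma tent_eq0 x : r <= `|x - x0| -> tent x = 0.
Proof.
by move=> rx; rewrite /tent max_r// subr_le0 ler_pdivlMr// mul1r.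
Qed.

Lemma tent_lipschitz x y : `|tent x - tent y| <= `|x - y| / r.
Proof.
have h : `| `|x - x0| / r - `|y - x0| / r| <= `|x - y| / r.
  rewrite -mulrBl normrM [X in _ * X]ger0_norm ?invr_ge0 ?(ltW r0)//.
  rewrite ler_wpM2r ?invr_ge0 ?(ltW r0)//; apply: le_trans (ler_dist_dist _ _) _.
  by rewrite opprB addrA subrK.
move: h; rewrite /tent; set a := _ / r; set b := _ / r; set e := _ / r.
rewrite !ler_norml => /andP[h1 h2].
rewrite /Order.max; do !case: ifPn; rewrite -?leNgt => *; apply/andP; split; lra.
Qed.

Let G (z : V * V) : R := `|tent z.1 - tent z.2| `^ p * quasi_kernel z.

Let G_ge0 z : 0 <= G z.
Proof. by rewrite /G mulr_ge0 ?powR_ge0 ?quasi_kernel_ge0. Qed.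

Let mG : measurable_fun setT G.
Proof.
apply: measurable_energy; first exact: measurable_quasi_kernel.
exact: measurable_tent.
Qed.

Let mGx x : measurable_fun setT (fun y => G (x, y)).
Proof. by apply: (measurableT_comp mG); exact: measurable_pair1. Qed.

Let GC x y : G (x, y) = G (y, x).
Proof. by rewrite /G /quasi_kernel quasi_distC /= distrC. Qed.

(** At quasi-distance [rho <= 1] from [x] the Lipschitz bound provides [rho ^ p], which
    leaves the exponent [a = p * (1 - s)] beyond the volume; at [rho > 1] the
    bound of the tent by [1] leaves the exponent [a = p * s]. *)
Lemma tent_energy_slice : exists K : R, forall x, `|x - x0| <= r ->
  (\int[mu]_y (G (x, y))%:E <= K%:E)%E.
Proof.
have [C C0 vol] := quasi_ball_volume.
have [L L0 hL] := translation_lipschitz (`|x0| + r).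
have a1 : 0 < p * (1 - s) by rewrite mulr_gt0 ?subr_gt0//; have := p2; lra.
have a2 : 0 < p * s by rewrite mulr_gt0//; have := p2; lra.
have e0 : 0 < Q%:R + p * s by rewrite ltr_wpDl.
have A0 : 0 <= (L / r) `^ p by exact: powR_ge0.
exists ((L / r) `^ p * 2 ^+ Q * C / (1 - 2^-1 `^ (p * (1 - s))) +
        1 * 2 ^+ Q * C / (1 - 2^-1 `^ (p * s))) => x xr.
have xR : `|x| <= `|x0| + r.
  by rewrite -[x](subrK x0) addrC; apply: le_trans (ler_normD _ _) _; rewrite lerD2l.
pose D := [set y | quasi_dist (x, y) <= 1].
have mD : measurable D by exact: (measurable_sublevel 1 (measurable_quasi_dist x)).
pose g1 y := G (x, y) * \1_D y; pose g2 y := G (x, y) * \1_(~` D) y.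
have g1_ge0 y : 0 <= g1 y by rewrite mulr_ge0// indicE ler0n.
have g2_ge0 y : 0 <= g2 y by rewrite mulr_ge0// indicE ler0n.
have mg1 : measurable_fun setT g1.
  by apply: measurable_funM; [exact: mGx|exact: measurable_indic].
have mg2 : measurable_fun setT g2.
  by apply: measurable_funM; [exact: mGx|apply: measurable_indic; exact: measurableC].
have -> : (\int[mu]_y (G (x, y))%:E = \int[mu]_y (g1 y)%:E + \int[mu]_y (g2 y)%:E)%E.
  rewrite -ge0_integralD//.
  - apply: eq_integral => y _; rewrite -EFinD /g1 /g2 -mulrDr !indicE in_setC.
    by case: (y \in D); rewrite ?addr0 ?add0r mulr1.
  - by move=> y _; rewrite lee_fin.
  - by apply/measurable_EFinP.
  - by move=> y _; rewrite lee_fin.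
  - by apply/measurable_EFinP.
rewrite EFinD; apply: leeD.
  apply: (integral_dyadic_near (measurable_quasi_dist x) mg1 g1_ge0 A0 a1 (vol x)).
  move=> y; rewrite /g1 mulf_eq0 negb_or => /andP[Gy].
  rewrite indicE pnatr_eq0 eqb0 negbK => /set_mem Dy.
  have rho_gt0 : 0 < quasi_dist (x, y).
    rewrite lt_neqAle N_ge0 andbT eq_sym; apply: contra_neq Gy => h.
    by rewrite /G /quasi_kernel h powR0 ?gt_eqF// invr0 mulr0.
  split; first by rewrite rho_gt0.
  rewrite mem_set// mulr1 /G /quasi_kernel /=.
  set rho := quasi_dist (x, y) in rho_gt0 *.
  rewrite powRD; last by rewrite (gt_eqF rho_gt0) implybT.
  rewrite powR_mulrn ?(ltW rho_gt0)// mulrBr mulr1.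
  rewrite powRB; last by rewrite (gt_eqF rho_gt0) implybT.
  have X0 : 0 < rho ^+ Q by rewrite exprn_gt0.
  have Y0 : 0 < rho `^ (p * s) by rewrite powR_gt0.
  rewrite (_ : _ * _ / _ = ((L / r) `^ p * rho `^ p) / (rho ^+ Q * rho `^ (p * s))); last first.
    by field; rewrite !gt_eqF.
  rewrite ler_wpM2r ?invr_ge0 ?mulr_ge0 ?(ltW X0) ?(ltW Y0)//.
  rewrite -powRM ?divr_ge0 ?(ltW r0) ?(ltW rho_gt0)//.
  have p0 : 0 <= p by have := p2; lra.
  have Lr0 : 0 <= L / r * rho by rewrite !mulr_ge0 ?invr_ge0 ?(ltW r0) ?(ltW rho_gt0).
  rewrite (ge0_ler_powR p0) ?nnegrE//.
  apply: le_trans (tent_lipschitz x y) _; rewrite mulrAC ler_wpM2r ?invr_ge0 ?(ltW r0)//.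
  by rewrite distrC; exact: hL.
apply: (integral_dyadic_far (measurable_quasi_dist x) mg2 g2_ge0 ler01 a2 (vol x)).
move=> y; rewrite /g2 mulf_eq0 negb_or => /andP[Gy].
rewrite indicE pnatr_eq0 eqb0 negbK => /set_mem Dy.
have rho1 : 1 < quasi_dist (x, y) by rewrite ltNge; apply/negP => h; exact: Dy.
split => //; rewrite mem_set// mulr1 mul1r /G /quasi_kernel /=.
set rho := quasi_dist (x, y) in rho1 *.
have rho_gt0 : 0 < rho by lra.
rewrite powRD; last by rewrite (gt_eqF rho_gt0) implybT.
rewrite powR_mulrn ?(ltW rho_gt0)// powRN invfM [_^-1 * _]mulrC.
rewrite ler_piMl ?mulr_ge0 ?invr_ge0 ?powR_ge0 ?exprn_ge0 ?(ltW rho_gt0)//.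
rewrite [leRHS](_ : 1 = 1 `^ p); last by rewrite powR1.
have p0 : 0 <= p by have := p2; lra.
rewrite (ge0_ler_powR p0) ?nnegrE//.
have /andP[hx0 hx1] := tent01 x; have /andP[hy0 hy1] := tent01 y.
by rewrite ler_norml; apply/andP; split; lra.
Qed.

(** The integrand is symmetric and vanishes unless one of the two points lies in the
    support [S], so that slices over [S] suffice. *)
Lemma tent_energy_lty : (kernel_energy mu quasi_kernel p tent < +oo)%E.
Proof.
have [K hK] := tent_energy_slice.
pose S := [set x : V | `|x - x0| <= r].
have mS : measurable S.
  apply: measurable_sublevel; apply: continuous_measurable_rV => x.
  apply: (@continuous_comp _ _ _ (fun x => x - x0) (fun x => `|x|)).
    exact: (@cvgB _ _ _ (nbhs x) (nbhs_filter x) id (cst x0) x x0 cvg_id (@cvg_cst _ x0 _ _ (nbhs_filter x))).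
  exact: norm_continuous.
have Sfin : (mu S < +oo)%E.
  pose bx (c : R) : V := \row_j (x0 0 j + c).
  have Sbox : S `<=` box (bx (- (r + 1))) (bx (r + 1)).
    move=> x Sx i; rewrite /bx !mxE in_itv/=.
    have := le_trans (coord_le_norm (x - x0) i) Sx; rewrite !mxE ler_norml => /andP[h1 h2].
    by apply/andP; split; lra.
  apply: (@le_lt_trans _ _ (mu (box (bx (- (r + 1))) (bx (r + 1))))).
    by apply: le_measure; rewrite ?inE//; exact: measurable_box.
  rewrite lebesgue_rV_box ?ltry// => i; rewrite /bx !mxE lerD2l.
  by have := r0; lra.
have GS z : G z <= \1_S z.1 * G z + \1_S z.2 * G z.
  have [h1|/ltW h1] := leP `|z.1 - x0| r.
    by rewrite indicE mem_set// mul1r lerDl mulr_ge0// indicE ler0n.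
  have [h2|/ltW h2] := leP `|z.2 - x0| r.
    by rewrite [X in _ + X * _]indicE mem_set// mul1r lerDr mulr_ge0// indicE ler0n.
  have p0 : p != 0 by rewrite gt_eqF//; have := p2; lra.
  have -> : G z = 0 by rewrite /G !tent_eq0// subrr normr0 powR0// mul0r.
  by rewrite !mulr0 addr0.
have mi1 : measurable_fun setT (fun z : V * V => \1_S z.1 * G z).
  apply: measurable_funM => //; apply: (@measurableT_comp _ _ _ _ _ _ (\1_S : V -> R)).
    exact: measurable_indic.
  exact: measurable_fst.
have mi2 : measurable_fun setT (fun z : V * V => \1_S z.2 * G z).
  apply: measurable_funM => //; apply: (@measurableT_comp _ _ _ _ _ _ (\1_S : V -> R)).
    exact: measurable_indic.
  exact: measurable_snd.
have i0 (z : V * V) (x : V) : 0 <= \1_S x * G z by rewrite mulr_ge0// indicE ler0n.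
have half : (\int[mu]_x \int[mu]_y (\1_S x * G (x, y))%:E <= `|K|%:E * mu S)%E.
  apply: (@le_trans _ _ (\int[mu]_x (`|K| * \1_S x)%:E)%E).
    apply: ge0_le_integral => //.
    - by move=> x _; apply: integral_ge0 => y _; rewrite lee_fin.
    - have := @measurable_fun_fubini_tonelli_F _ _ V V R mu (fun z : V * V => (\1_S z.1 * G z)%:E).
      by apply; [apply/measurable_EFinP|move=> z; rewrite lee_fin].
    - by apply/measurable_EFinP; apply: measurable_funM => //; exact: measurable_indic.
    move=> x _; rewrite indicE; case: (boolP (x \in S)) => [/set_mem Sx|_].
      under eq_integral do rewrite mul1r.
      by rewrite mulr1; apply: le_trans (hK x Sx) _; rewrite lee_fin ler_norm.
    by under eq_integral do rewrite mul0r; rewrite integral0 mulr0.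
  under eq_integral do rewrite EFinM.
  by rewrite ge0_integralZl_EFin// ?integral_indic ?setIT//; apply/measurable_EFinP; exact: measurable_indic.
have halffin : (`|K|%:E * mu S < +oo)%E by rewrite lte_mul_pinfty.
apply: (@le_lt_trans _ _ (\int[(mu \x mu)%E]_z ((\1_S z.1 * G z)%:E + (\1_S z.2 * G z)%:E))%E).
  apply: ge0_le_integral => //.
  - by move=> z _; rewrite lee_fin G_ge0.
  - by apply/measurable_EFinP.
  - by apply: emeasurable_funD; apply/measurable_EFinP.
  by move=> z _; rewrite -EFinD lee_fin; exact: GS.
rewrite ge0_integralD//; last 4 first.
- by move=> z _; rewrite lee_fin.
- by apply/measurable_EFinP.
- by move=> z _; rewrite lee_fin.
- by apply/measurable_EFinP.
apply: lte_add_pinfty.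
  rewrite fubini_tonelli1; last 2 first.
  - by apply/measurable_EFinP.
  - by move=> z; rewrite lee_fin.
  exact: le_lt_trans half halffin.
rewrite fubini_tonelli1; last 2 first.
- by apply/measurable_EFinP.
- by move=> z; rewrite lee_fin.
rewrite fubini_tonelli; last 2 first.
- by apply/measurable_EFinP.
- by move=> z; rewrite lee_fin.
apply: le_lt_trans halffin; apply: le_trans half.
rewrite le_eqVlt; apply/orP; left; apply/eqP; apply: eq_integral => y _.
by apply: eq_integral => x _ /=; rewrite GC.
Qed.

End tent.

(** * The reaction term *)

Section reaction.
Context {R : realType}.
Variables (P m q lam : R).
Hypotheses (P2 : 2 <= P) (m1 : 1 <= m) (q1 : 1 <= q) (lam0 : 0 < lam).

Definition reaction (t : R) : R :=
  `|t| `^ (P - 2) * t + lam * (`|t| `^ (m - 1) + `|t| `^ (q - 1)).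

Definition reaction_primitive (t : R) : R :=
  `|t| `^ P / P + lam * (`|t| `^ m / m + `|t| `^ q / q).

Lemma reaction_ge0E t : 0 <= t ->
  reaction t = t `^ (P - 1) + lam * (t `^ (m - 1) + t `^ (q - 1)).
Proof.
move=> t0; rewrite /reaction -/(odd_powR P t).
rewrite -[odd_powR P t]ger0_norm; last by rewrite /odd_powR mulr_ge0 ?powR_ge0.
by rewrite normr_odd_powR// (ger0_norm t0).
Qed.

Lemma reaction_primitive_continuous : continuous reaction_primitive.
Proof.
have c r : 1 <= r -> continuous (fun t : R => `|t| `^ r / r).
  by move=> r1 t; apply: cvgMl; apply: normr_powR_continuous; lra.
have P1 : 1 <= P by have := P2; lra.
move=> t; apply: cvgD; first exact: c.
by apply: cvgMr; apply: cvgD; exact: c.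
Qed.

Lemma measurable_reaction : measurable_fun setT reaction.
Proof.
have mp r : measurable_fun setT (fun t : R => `|t| `^ r).
  by apply: (@measurableT_comp _ _ _ _ _ _ (@powR R ^~ r)).
apply: measurable_funD; first by apply: measurable_funM.
by apply: measurable_funM => //; exact: measurable_funD.
Qed.

Lemma reaction_tangent s t : 0 <= s -> 0 <= t ->
  reaction s * (t - s) <= reaction_primitive t - reaction_primitive s.
Proof.
move=> s0 t0; rewrite reaction_ge0E// /reaction_primitive !ger0_norm//.
have tan r : 1 <= r -> s `^ (r - 1) * (t - s) <= t `^ r / r - s `^ r / r.
  move=> r1; have r0 : 0 < r by lra.
  rewrite -mulrBl ler_pdivlMr// mulrC mulrA.
  exact: powR_tangent.
have P1 : 1 <= P by have := P2; lra.
have h1 := tan _ P1; have h2 := tan _ m1; have h3 := tan _ q1.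
have h4 := ler_wpM2l (ltW lam0) (lerD h2 h3).
rewrite mulrDl -mulrA mulrDl.
move: (s `^ (P - 1) * (t - s)) (s `^ (m - 1) * (t - s)) (s `^ (q - 1) * (t - s)) h1 h4.
move: (t `^ P / P) (s `^ P / P) (t `^ m / m) (s `^ m / m) (t `^ q / q) (s `^ q / q).
by move=> a b c e f g x y z h1 h4; lra.
Qed.

Lemma reaction_nondecreasing s t : 0 <= s <= t -> 0 <= reaction s <= reaction t.
Proof.
move=> /andP[s0 st]; have t0 : 0 <= t by lra.
rewrite !reaction_ge0E//; apply/andP; split.
  by rewrite addr_ge0 ?mulr_ge0 ?addr_ge0 ?powR_ge0// ltW.
have mono r : 1 <= r -> s `^ (r - 1) <= t `^ (r - 1).
  by move=> r1; rewrite ge0_ler_powR ?nnegrE ?subr_ge0.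
have P1 : 1 <= P by have := P2; lra.
by rewrite lerD ?mono// ler_wpM2l ?lerD ?mono// ltW.
Qed.

Lemma reaction_primitive_le s t : 0 <= s <= t ->
  reaction_primitive s <= reaction_primitive t.
Proof.
move=> /andP[s0 st]; have t0 : 0 <= t by lra.
have := reaction_tangent s0 t0; rewrite -subr_ge0 => h.
have /andP[h0 _] : 0 <= reaction s <= reaction t by apply: reaction_nondecreasing; rewrite s0.
by have : 0 <= reaction s * (t - s) by [rewrite mulr_ge0// subr_ge0]; lra.
Qed.

Lemma reaction_primitive0 : reaction_primitive 0 = 0.
Proof.
rewrite /reaction_primitive normr0 !powR0 ?mul0r ?addr0 ?mulr0 ?addr0// gt_eqF//.
- by have := q1; lra.
- by have := m1; lra.
- by have := P2; lra.
Qed.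

Lemma reaction_primitive_ge t : 0 <= t ->
  lam / m * t `^ m <= reaction_primitive t.
Proof.
move=> t0; rewrite /reaction_primitive (ger0_norm t0).
have a0 : 0 <= t `^ P / P by rewrite divr_ge0 ?powR_ge0//; have := P2; lra.
have b0 : 0 <= lam * (t `^ q / q).
  by rewrite mulr_ge0 ?(ltW lam0)// divr_ge0 ?powR_ge0//; have := q1; lra.
by rewrite (_ : lam / m * _ = lam * (t `^ m / m)); [lra|ring].
Qed.

End reaction.

(** * Lebesgue spaces *)

Section lebesgue_space.
Context d (T : measurableType d) (R : realType).

Lemma ae_prod (mu : {sigma_finite_measure set T -> \bar R}) (P : T -> Prop) :
  {ae mu, forall x, P x} -> {ae (mu \x mu)%E, forall z, P z.1 /\ P z.2}.
Proof.
move=> [A [mA A0 PA]]; exists ((A `*` setT) `|` (setT `*` A)); split.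
- by apply: measurableU; exact: measurableX.
- apply: null_set_setU; try exact: measurableX.
    apply: (eq_trans (product_measure1E mu mu mA measurableT)).
    by rewrite [X in (X * _)%E](_ : _ = 0%E) ?mul0e.
  apply: (eq_trans (product_measure1E mu mu measurableT mA)).
  by rewrite [X in (_ * X)%E](_ : _ = 0%E) ?mule0.
move=> z /= /not_andP[h|h]; [left|right]; split => //; exact: PA.
Qed.

Lemma mem_Lfun (mu : {measure set T -> \bar R}) (p : R) (u : T -> R) :
  measurable_fun setT u -> (\int[mu]_x (`|u x| `^ p)%:E < +oo)%E ->
  u \in Lfun mu p%:E.
Proof.
move=> mu_ up; rewrite inE; apply/andP; split; first by rewrite inE.
by rewrite inE /= /finite_norm unlock poweR_lty.
Qed.

Lemma Lfun_measurable (mu : {measure set T -> \bar R}) (p : R) (u : T -> R) :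
  u \in Lfun mu p%:E -> measurable_fun setT u.
Proof. by move=> /sub_Lfun_mfun; rewrite inE. Qed.

(** Because [|u| <= |u| ^ p + 1]. *)
Lemma Lfun_integrable_finite (mu : {measure set T -> \bar R}) (p : R) (u : T -> R)
    (D : set T) :
  1 <= p -> measurable D -> (mu D < +oo)%E -> u \in Lfun mu p%:E ->
  mu.-integrable D (EFin \o u).
Proof.
move=> p1 mD Dfin up; have mu_ := Lfun_measurable up.
have i1 : mu.-integrable D (fun x => (`|u x| `^ p)%:E).
  exact: (integrableS measurableT mD (@subsetT _ _) (Lfun_integrable p1 up)).
have i2 : mu.-integrable D (EFin \o cst 1).
  apply/integrableP; split; first exact/measurable_EFinP.
  by under eq_integral do rewrite /= normr1; rewrite integral_cst// mul1e.
apply: (le_integrable mD _ _ (integrableD mD i1 i2)).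
  by apply/measurable_EFinP; exact: measurable_funTS.
move=> x _ /=; rewrite lee_fin.
rewrite [leRHS]ger0_norm ?addr_ge0 ?powR_ge0//.
have [u1|/ltW u1] := leP `|u x| 1; first by rewrite (le_trans u1)// lerDr powR_ge0.
by rewrite (le_trans (le1r_powR u1 p1))// lerDl.
Qed.

End lebesgue_space.

(** * Bounded domains *)

Section bounded_domain.
Context {R : realType} {n : nat}.
Local Notation V := 'rV[R]_n.
Local Notation mu := (lebesgue_rV R n).

Lemma bounded_measure_lty (Omega : set V) (r : R) : measurable Omega -> 0 <= r ->
  (forall x, Omega x -> `|x| <= r) -> (mu Omega < +oo)%E.
Proof.
move=> mO r0 Or.
have Obox : Omega `<=` box (const_mx (- (r + 1)) : V) (const_mx (r + 1)).
  move=> x Ox i; rewrite !mxE in_itv/=.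
  have := le_trans (coord_le_norm x i) (Or x Ox); rewrite ler_norml => /andP[h1 h2].
  by apply/andP; split; lra.
apply: (@le_lt_trans _ _ (mu (box (const_mx (- (r + 1)) : V) (const_mx (r + 1))))).
  by apply: le_measure; rewrite ?inE//; exact: measurable_box.
by rewrite lebesgue_rV_box ?ltry// => i; rewrite !mxE; lra.
Qed.

Lemma box_outside (r : R) : (0 < n)%N ->
  mu (box (const_mx r : V) (const_mx (r + 1))) = 1%:E /\
  forall x, box (const_mx r : V) (const_mx (r + 1)) x -> r < `|x|.
Proof.
move=> n0; split.
  rewrite lebesgue_rV_box => [|i]; last by rewrite !mxE lerDl.
  by congr EFin; rewrite big1// => i _; rewrite !mxE addrAC subrr add0r.
move=> x /(_ (Ordinal n0)); rewrite !mxE in_itv/= => /andP[rx _].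
by apply: (lt_le_trans rx); apply: le_trans (ler_norm _) (coord_le_norm _ _).
Qed.

Lemma norm_box (r : R) (x : V) : 0 <= r ->
  box (const_mx r : V) (const_mx (r + 1)) x -> `|x| <= r + 1.
Proof.
move=> r0 Bx; apply: norm_le_coord => [|i]; first by rewrite addr_ge0.
have := Bx i; rewrite !mxE in_itv/= => /andP[h1 h2].
by rewrite ger0_norm//; lra.
Qed.

(** The tent is at least [1 / 2] on a box of half-width [r / 2]. *)
Lemma tent_integral_gt0 (Omega : set V) (x0 : V) (r m : R) : measurable Omega ->
  (mu Omega < +oo)%E -> 0 < r -> 0 < m -> (forall x, `|x - x0| < r -> Omega x) ->
  0 < \int[mu]_(x in Omega) (tent x0 r x `^ m).
Proof.
move=> mO Ofin r0 m0 rO.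
have mb : measurable_fun setT (fun x => tent x0 r x `^ m).
  apply: (@measurableT_comp _ _ _ _ _ _ (@powR R ^~ m)); first exact: measurable_powR.
  exact: measurable_tent.
have b1 x : tent x0 r x `^ m <= 1.
  rewrite [leRHS](_ : 1 = 1 `^ m); last by rewrite powR1.
  by have /andP[h0 h1] := tent01 x0 r0 x; rewrite ge0_ler_powR ?nnegrE// ltW.
have ib : mu.-integrable Omega (EFin \o (fun x => tent x0 r x `^ m)).
  apply: (@integrable_bounded _ _ _ _ _ mO Ofin _ 1); first exact: measurable_funTS.
  by move=> x _; rewrite ger0_norm ?powR_ge0.
pose bx (c : R) : V := \row_j (x0 0 j + c).
pose B := box (bx (- (r / 2))) (bx (r / 2)).
have mB : measurable B by exact: measurable_box.
have Bx x : B x -> `|x - x0| <= r / 2.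
  move=> Bx; apply: norm_le_coord => [|i]; first lra.
  have := Bx i; rewrite /bx !mxE in_itv/= ler_norml => /andP[h1 h2].
  by apply/andP; split; lra.
have BO : B `<=` Omega by move=> x /Bx h; apply: rO; lra.
have Bb x : B x -> 2^-1 `^ m <= tent x0 r x `^ m.
  move=> /Bx h; have /andP[h0 h1] := tent01 x0 r0 x.
  have h2 : (0 : R) <= 2^-1 by lra.
  rewrite (ge0_ler_powR (ltW m0)) ?nnegrE//.
  rewrite /tent le_max; apply/orP; left.
  have : `|x - x0| / r <= 2^-1 by rewrite ler_pdivrMr//; lra.
  lra.
have muB : mu B = (r ^+ n)%:E.
  rewrite lebesgue_rV_box => [|i]; last by rewrite /bx !mxE; lra.
  congr EFin; rewrite (eq_bigr (fun=> r)) => [|i _]; last by rewrite /bx !mxE; lra.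
  by rewrite prodr_const card_ord.
rewrite -lte_fin fineK; last exact: (integrable_fin_num mO ib).
apply: (@lt_le_trans _ _ ((2^-1 `^ m)%:E * mu B)%E).
  by rewrite muB -EFinM lte_fin mulr_gt0 ?powR_gt0 ?exprn_gt0//; lra.
rewrite -integral_cst//.
apply: (@le_trans _ _ (\int[mu]_(x in B) (tent x0 r x `^ m)%:E)%E).
  apply: ge0_le_integral => //.
  - by move=> x _; rewrite lee_fin powR_ge0.
  - by apply/measurable_EFinP; exact: measurable_funTS.
apply: ge0_subset_integral => //.
- by apply/measurable_EFinP; exact: measurable_funTS.
- by move=> x _; rewrite lee_fin powR_ge0.
Qed.

End bounded_domain.

(** * The kernel of a stratified group *)

Section stratified.
Context {R : realType} {k : nat} {n : 'I_k.+1 -> nat}.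
Local Notation V := 'rV[R]_(\sum_(i < k.+1) n i).
Local Notation mu := (lebesgue_rV R (\sum_(i < k.+1) n i)).

Definition weight (j : 'I_(\sum_(i < k.+1) n i)) : nat := (tagnat.sig1 j).+1.

Lemma dilationE (l : R) (x : V) j : dilation l x 0 j = l ^+ weight j * x 0 j.
Proof. by rewrite /dilation !mxE tagnat.sig2K. Qed.

Lemma weight_mono i j : (weight i < weight j)%N -> (i < j)%N.
Proof.
rewrite /weight ltnS => h; rewrite ltnNge; apply/negP => ji.
have := @tagnat.le_sig1 _ n j i ji; rewrite leEord leqNgt; exact/negP/negPn.
Qed.

Lemma sum_weight : (\sum_j weight j)%N = homogeneous_dim n.
Proof.
rewrite /homogeneous_dim (reindex _ tagnat.rank_bij_on)/=.
rewrite (eq_bigr (fun p : {i & 'I_(n i)} => (tag p).+1)) => [|p _]; last first.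
  by rewrite /weight /tagnat.sig1 tagnat.rankK.
rewrite -(@sig_big_dep _ _ _ _ (fun i => 'I_(n i)) xpredT (fun=> xpredT)
  (fun (i : 'I_k.+1) _ => i.+1))/=.
apply: eq_bigr => i _; rewrite sum_nat_const card_ord mulnC.
by [].
Qed.

Variables (G : stratified_group R n) (N : homogeneous_norm G) (s p : R).

Lemma kernel_weightE z : (kernel_weight N s p z)^-1 =
  quasi_kernel weight N (sg_op G) (sg_inv G) s p z.
Proof.
case: z => x y; rewrite /quasi_kernel sum_weight /kernel_weight.
rewrite (quasi_distC (@hnorm_inv _ _ _ _ N) (@sg_opA _ _ _ G) (@sg_op0x _ _ _ G)
  (@sg_opx0 _ _ _ G) (@sg_opVx _ _ _ G) (@sg_opxV _ _ _ G)).
by [].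
Qed.

Lemma sg_op_continuous : continuous (fun z : V * V => sg_op G z.1 z.2).
Proof. exact: (sg_op_smooth G 0). Qed.

Lemma sg_inv_continuous : continuous (sg_inv G).
Proof. exact: (sg_inv_smooth G 0). Qed.

Definition gagliardo_kernel (z : V * V) : R := (kernel_weight N s p z)^-1.

Lemma measurable_gagliardo_kernel : measurable_fun setT gagliardo_kernel.
Proof.
rewrite (_ : gagliardo_kernel = quasi_kernel weight N (sg_op G) (sg_inv G) s p).
  exact: (measurable_quasi_kernel weight (@hnorm_continuous _ _ _ _ N)
    sg_op_continuous sg_inv_continuous s p).
by apply/funext => z; exact: kernel_weightE.
Qed.

Lemma gagliardo_kernel_ge0 z : 0 <= gagliardo_kernel z.
Proof. by rewrite invr_ge0 powR_ge0. Qed.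

Lemma gagliardo_kernel_tent_lty (x0 : V) (r : R) : 0 < s -> s < 1 -> 2 <= p -> 0 < r ->
  (kernel_energy mu gagliardo_kernel p (tent x0 r) < +oo)%E.
Proof.
move=> s0 s1 p2 r0.
rewrite (_ : gagliardo_kernel = quasi_kernel weight N (sg_op G) (sg_inv G) s p); last first.
  by apply/funext => z; exact: kernel_weightE.
have [C1 dC] := sg_op_smooth G 1.
apply: (tent_energy_lty (wt := weight) (dil := @dilation R k n)) => //.
- exact: weight_mono.
- exact: dilationE.
- exact: hnorm_continuous.
- exact: hnorm_ge0.
- exact: hnorm_eq0.
- exact: hnorm_dilation.
- exact: hnorm_inv.
- exact: sg_opA.
- exact: sg_op0x.
- exact: sg_opx0.
- exact: sg_opVx.
- exact: sg_opxV.
- exact: sg_dilationM.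
- exact: sg_op_continuous.
- exact: sg_inv_continuous.
Qed.

(** The quasi-distance is bounded on bounded sets, by continuity and compactness. *)
Lemma gagliardo_kernel_lower_bound (r : R) : 0 < s -> 0 < p -> exists2 kap : R, 0 < kap &
  forall x y : V, `|x| <= r -> `|y| <= r -> x <> y -> kap <= gagliardo_kernel (x, y).
Proof.
move=> s0 p0; have cB := @closed_norm_ball_compact R (\sum_(i < k.+1) n i) r.
have cq := quasi_dist_continuous (@hnorm_continuous _ _ _ _ N) sg_op_continuous sg_inv_continuous.
have := continuous_compact (continuous_subspaceT cq) (compact_setX cB cB).
move=> /compact_bounded[M [_ hM]]; pose D := `|M| + 1.
have D0 : 0 < D by rewrite ltr_wpDl.
have Q0 : 0 <= (homogeneous_dim n)%:R + p * s by rewrite addr_ge0// mulr_ge0// ltW.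
exists (D `^ ((homogeneous_dim n)%:R + p * s))^-1; first by rewrite invr_gt0 powR_gt0.
move=> x y xr yr xy; rewrite /gagliardo_kernel /kernel_weight /=.
have q0 : 0 < N (sg_op G (sg_inv G y) x).
  rewrite lt_neqAle hnorm_ge0 andbT eq_sym; apply/eqP => /hnorm_eq0 h; apply: xy.
  by rewrite -[x](sg_op0x G) -(sg_opxV G y) -(sg_opA G) h (sg_opx0 G).
have qD : N (sg_op G (sg_inv G y) x) <= D.
  apply: le_trans (ler_norm _) _; apply: (hM D).
    by rewrite /D; have := ler_norm M; lra.
  by exists (y, x).
by rewrite lef_pV2 ?posrE ?powR_gt0// ge0_ler_powR ?nnegrE// ltW.
Qed.

Lemma gagliardo_lty u : 0 < p ->
  (gagliardo N s p u < +oo)%E <-> (kernel_energy mu gagliardo_kernel p u < +oo)%E.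
Proof.
move=> p0; split => [h|h]; last exact: poweR_lty.
by apply: (@lty_poweRy _ _ p^-1); rewrite ?invr_neq0 ?gt_eqF.
Qed.

End stratified.

(** * Weak solutions *)

Section weak_formulation.
Context {R : realType} {k : nat} {n : 'I_k.+1 -> nat}.
Local Notation V := 'rV[R]_(\sum_(i < k.+1) n i).
Local Notation mu := (lebesgue_rV R (\sum_(i < k.+1) n i)).
Variables (G : stratified_group R n) (N : homogeneous_norm G) (s p : R).
Hypothesis p2 : 2 <= p.
Variable Omega : set V.
Hypotheses (mOmega : measurable Omega) (Omega_fin : (mu Omega < +oo)%E).

Lemma between_X0sp (M : R) u : between Omega M u ->
  (kernel_energy mu (gagliardo_kernel N s p) p u < +oo)%E -> X0sp N s p Omega u.
Proof.
move=> [mu_ uM u0] Eu; have p0 : 0 < p by have := p2; lra.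
split; last by apply: aeW => x; exact: u0.
split; last exact/gagliardo_lty.
apply: mem_Lfun => //.
apply: (@le_lt_trans _ _ (\int[mu]_(x in Omega) (cst (M `^ p)%:E x))%E); last first.
  by rewrite integral_cst// lte_mul_pinfty ?lee_fin ?powR_ge0.
rewrite [leRHS]integral_mkcond; apply: ge0_le_integral => //.
- apply/measurable_EFinP; apply: (@measurableT_comp _ _ _ _ _ _ (@powR R ^~ p)).
    exact: measurable_powR.
  exact: measurableT_comp.
- by apply/(measurable_restrictT _ mOmega); exact: measurable_cst.
move=> x _; rewrite patchE; case: ifPn => [_|/negP xO].
  have /andP[u_ge0 u_le] := uM x; rewrite lee_fin ger0_norm// ge0_ler_powR ?nnegrE ?(ltW p0)//.
  exact: le_trans u_ge0 u_le.
by rewrite (u0 x) ?normr0 ?powR0 ?gt_eqF// => Ox; apply: xO; rewrite inE.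
Qed.

(** Multiplying a test function by the indicator of [Omega] changes it on a negligible
    set only, and the pairs with a component in this set are negligible. *)
Lemma weak_solution_strict_test (f : V -> R -> R) u :
  X0sp N s p Omega u -> 
  (forall phi : V -> R, measurable_fun setT phi -> (forall x, ~ Omega x -> phi x = 0) ->
     mu.-integrable Omega (EFin \o phi) -> (kernel_energy mu (gagliardo_kernel N s p) p phi < +oo)%E ->
     (\int[(mu \x mu)%E]_z (energy_variation (gagliardo_kernel N s p) p u phi z)%:E =
      \int[mu]_(x in Omega) (f x (u x) * phi x)%:E)%E) ->
  weak_solution N s p Omega f u.
Proof.
move=> Xu hu; split => // phi [[phi_p phi_fin] phi0].
have p0 : 0 < p by have := p2; lra.
have mu_ : measurable_fun setT u by case: Xu => -[/Lfun_measurable].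
have mphi := Lfun_measurable phi_p.
pose psi (x : V) := phi x * \1_Omega x.
have psiO x : Omega x -> psi x = phi x by move=> Ox; rewrite /psi indicE mem_set ?mulr1.
have psi0 x : ~ Omega x -> psi x = 0.
  by move=> Ox; rewrite /psi indicE memNset// mulr0.
have mpsi : measurable_fun setT psi.
  by apply: measurable_funM => //; exact: measurable_indic.
have aeq : {ae mu, forall x, phi x = psi x}.
  apply: filterS phi0 => x h; have [Ox|Ox] := pselect (Omega x).
    by rewrite psiO.
  by rewrite psi0// h.
have aeq2 := ae_prod aeq.
have mk := measurable_gagliardo_kernel N s p.
have Epsi : (kernel_energy mu (gagliardo_kernel N s p) p psi < +oo)%E.
  have e : kernel_energy mu (gagliardo_kernel N s p) p phi = kernel_energy mu (gagliardo_kernel N s p) p psi.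
    apply: ge0_ae_eq_integral.
    - exact: measurableT.
    - by apply/measurable_EFinP; exact: (measurable_energy p mk mphi).
    - by apply/measurable_EFinP; exact: (measurable_energy p mk mpsi).
    - by move=> z _; rewrite lee_fin mulr_ge0 ?powR_ge0 ?gagliardo_kernel_ge0.
    - by move=> z _; rewrite lee_fin mulr_ge0 ?powR_ge0 ?gagliardo_kernel_ge0.
    by apply: filterS aeq2 => z [e1 e2] _; rewrite e1 e2.
  by rewrite -e; exact/gagliardo_lty.
have p1 : 1 <= p by have := p2; lra.
have iphi := Lfun_integrable_finite p1 mOmega Omega_fin phi_p.
have ipsi : mu.-integrable Omega (EFin \o psi).
  by apply: eq_integrable iphi => // x /set_mem Ox /=; rewrite psiO.
transitivity (\int[(mu \x mu)%E]_z (energy_variation (gagliardo_kernel N s p) p u psi z)%:E)%E.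
  apply: ae_eq_integral.
  - exact: measurableT.
  - by apply/measurable_EFinP; exact: (measurable_energy_variation mk p2 mu_ mphi).
  - by apply/measurable_EFinP; exact: (measurable_energy_variation mk p2 mu_ mpsi).
  by apply: filterS aeq2 => z [e1 e2] _; rewrite e1 e2.
rewrite (hu _ mpsi psi0 ipsi Epsi).
by apply: eq_integral => x /set_mem Ox; rewrite psiO.
Qed.

End weak_formulation.

Theorem theorem1p2 (R : realType) (k : nat) (n : 'I_k.+1 -> nat)
  (G : stratified_group R n) (N : homogeneous_norm G)
  (Omega : set 'rV[R]_(\sum_(i < k.+1) n i))
  (Omega0 : Omega !=set0) (Omega_bounded : bounded_set Omega)
  (Omega_open : open Omega)
  (s p : R) (s0 : 0 < s) (s1 : s < 1) (p1 : 1 < p)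
  (p_lt : p < (homogeneous_dim n)%:R / s) (p_ge2 : 2 <= p)
  (m q : R) (m1 : 1 <= m) (mp : m < p) (pq : p <= q)
  (q_lt : q < critical_exponent n s p) :
  exists Lambda : set R,
    [/\ Lambda !=set0, open Lambda, is_interval Lambda,
        Lambda `<=` [set lambda | 0 < lambda] &
        forall lambda, Lambda lambda ->
          exists u,
            [/\ weak_solution N s p Omega
                  (fun _ t => `|t| `^ (critical_exponent n s p - 2) * t
                              + lambda * (`|t| `^ (m - 1) + `|t| `^ (q - 1))) u,
                {ae lebesgue_rV R _, forall x, 0 <= u x} &
                ~ {ae lebesgue_rV R _, forall x, u x = 0}]].
Proof.
set P := critical_exponent n s p in q_lt *.
have p0 : 0 < p by lra.
have P2 : 2 <= P by lra.
have q1 : 1 <= q by lra.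
have dim0 : (0 < \sum_(i < k.+1) n i)%N.
  rewrite lt0n; apply/eqP => dim0; move: p_lt.
  rewrite -sum_weight big1 ?mul0r; first by rewrite ltNge (ltW p0).
  by move=> j; have := ltn_ord j; rewrite [X in (_ < X)%N]dim0.
have [r r0 Or] : exists2 r : R, 0 <= r & forall x, Omega x -> `|x| <= r.
  case: Omega_bounded => r [_ hr]; exists (`|r| + 1) => [|x Ox].
    by rewrite addr_ge0.
  by apply: hr Ox; have := ler_norm r; lra.
have mO : measurable Omega by exact: open_measurable_rV.
have Ofin := bounded_measure_lty mO r0 Or.
have [muB Bout] := @box_outside R _ r dim0.
have [kap kap0 hkap] := @gagliardo_kernel_lower_bound R k n G N s p (r + 1) s0 p0.
(* At this height the critical term is half of the barrier [kap * M ^ (p - 1)]; the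
   bound [lam0] keeps the other terms below the second half. *)
pose M := (kap / 2) `^ (P - p)^-1.
have M0 : 0 < M by rewrite powR_gt0// divr_gt0.
have MP : M `^ (P - 1) = kap / 2 * M `^ (p - 1).
  rewrite (_ : P - 1 = (P - p) + (p - 1)); last by ring.
  rewrite powRD; last by rewrite (gt_eqF M0) implybT.
  congr (_ * _); rewrite /M -powRrM mulVf ?powRr1//; first by rewrite divr_ge0// ltW.
  by rewrite gt_eqF// subr_gt0; lra.
pose S := M `^ (m - 1) + M `^ (q - 1).
have S0 : 0 < S by apply: addr_gt0; exact: powR_gt0.
pose lam0 := kap * M `^ (p - 1) / (2 * S).
have lam00 : 0 < lam0.
  by apply: divr_gt0; apply: mulr_gt0 => //; exact: powR_gt0.
exists `]0, lam0[%classic; split.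
- by exists (lam0 / 2); rewrite /= in_itv/=; apply/andP; split; lra.
- exact: interval_open.
- exact: interval_is_interval.
- by move=> l /=; rewrite in_itv/= => /andP[].
move=> lam /=; rewrite in_itv/= => /andP[l0 l1].
have [x1 Ox1] := Omega0.
have [e e0 eO] : exists2 e : R, 0 < e & forall x, `|x - x1| < e -> Omega x.
  have : nbhs x1 Omega by exact: open_nbhs_nbhs.
  rewrite -nbhs_ballE => -[e /= e0 eO]; exists e => // x xe; apply: eO.
  by rewrite -ball_normE /ball_ /= distrC.
have fM : reaction P m q lam M <= kap * 1 * M `^ (p - 1).
  rewrite reaction_ge0E ?(ltW M0)// MP mulr1 -/S.
  have : lam * S <= lam0 * S by rewrite ler_wpM2r ?ltW.
  have -> : lam0 * S = kap / 2 * M `^ (p - 1) by rewrite /lam0; field; rewrite gt_eqF.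
  lra.
have W_ge x y : Omega x -> box (const_mx r) (const_mx (r + 1)) y ->
    kap <= gagliardo_kernel N s p (x, y).
  move=> Ox By; have xr := Or _ Ox; have ry := Bout _ By.
  apply: hkap; [lra|exact: norm_box|].
  by move=> xy; move: ry; rewrite -xy ltNge xr.
have out x : Omega x -> ~ box (const_mx r) (const_mx (r + 1)) x.
  by move=> Ox /Bout; rewrite ltNge Or.
have m0 : 0 < m by lra.
have lm0 : 0 < lam / m by rewrite divr_gt0.
have tent0 x : ~ Omega x -> tent x1 e x = 0.
  by move=> Ox; apply: tent_eq0 => //; rewrite leNgt; apply/negP => /eO.
have F_ge t : 0 <= t <= M ->
    reaction_primitive P m q lam 0 + lam / m * t `^ m <= reaction_primitive P m q lam t.
  by move=> /andP[t0 _]; rewrite reaction_primitive0// add0r reaction_primitive_ge.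
have F_tan t t' : 0 <= t <= M -> 0 <= t' <= M -> reaction P m q lam t * (t' - t) <=
    reaction_primitive P m q lam t' - reaction_primitive P m q lam t.
  by move=> /andP[t0 _] /andP[t0' _]; exact: reaction_tangent.
have [u [bu Eu u_neq0 hu]] := @bounded_weak_solution _ _ R
  (lebesgue_rV R (\sum_(i < k.+1) n i)) (gagliardo_kernel N s p) Omega p
  (measurable_gagliardo_kernel N s p) (gagliardo_kernel_ge0 N s p) mO p_ge2
  (reaction_primitive P m q lam) (reaction P m q lam) M
  (box (const_mx r) (const_mx (r + 1))) 1 kap
  (@reaction_primitive_continuous R P m q lam P2 m1 q1) (ltW M0)
  (fun t => @reaction_primitive_le _ _ _ _ _ P2 m1 q1 l0 t M) F_tan
  (measurable_reaction P m q lam)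
  (fun t => @reaction_nondecreasing _ _ _ _ _ P2 m1 q1 l0 t M)
  (measurable_box _ _) muB (ltW kap0) out W_ge fM Ofin (tent x1 e) (lam / m) m
  lm0 m0 mp M0 F_ge (measurable_tent _ _) (tent01 _ e0) tent0
  (gagliardo_kernel_tent_lty N x1 s0 s1 p_ge2 e0)
  (tent_integral_gt0 mO Ofin e0 m0 eO).
exists u; split => //.
- apply: weak_solution_strict_test => //; first exact: between_X0sp bu Eu.
- by apply: aeW => x; have [_ /(_ x)/andP[]] := bu.
Qed.
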